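(* Let $\beta>0$ and $\alpha\in\mathbb{R}$ satisfy $|\alpha|<\beta$ and $|\alpha|+\beta=2$. For each even $N$ let $S=S_N\subset\{1,\dots,N\}$ with $|S|=N/2$, let $\sigma$ be distributed according to the block spin Ising Gibbs measure $\mu_{N,\alpha,\beta,S}$ described in the context, and let $m_1=\frac{2}{N}\sum_{i\in S}\sigma_i$, $m_2=\frac{2}{N}\sum_{i\notin S}\sigma_i$. Let $\rho$ be the probability measure on $\mathbb{R}$ with Lebesgue density $g(x)=\exp(-\tfrac{1}{12}x^4)/K$, where $K=\int_{\mathbb{R}}\exp(-\tfrac1{12}x^4)\,dx$. Then, as $N\to\infty$: \begin{enumerate} \item[(a)] If $\alpha>0$, then $\frac{\sqrt N}{2}(m_1-m_2)$ converges in distribution to a Gaussian with mean $0$ and variance $\frac{2}{2-(\beta-\alpha)}$. If $\alpha<0$, then $\frac{N^{1/4}}{2}(m_1-m_2)$ converges in distribution to $\rho$. \item[(b)] If $\alpha>0$, then $\frac{N^{1/4}}{2}(m_1+m_2)$ converges in distribution to $\rho$. If $\alpha<0$, then $\frac{\sqrt N}{2}(m_1+m_2)$ converges in distribution to a Gaussian with mean $0$ and variance $-\frac{1}{\alpha}$. \end{enumerate}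
   Context: Block spin Ising model: let $N$ be even and $S\subset\{1,\dots,N\}$ with $|S|=N/2$. For $i,j\in\{1,\dots,N\}$ write $i\sim j$ if $i,j\in S$ or $i,j\in S^c$, and $i\not\sim j$ otherwise. For parameters $\beta>0$, $|\alpha|\le\beta$, the Hamiltonian on $\{-1,+1\}^N$ is $$H_{N,\alpha,\beta,S}(\sigma)=-\frac{\beta}{2N}\sum_{i\sim j}\sigma_i\sigma_j-\frac{\alpha}{2N}\sum_{i\not\sim j}\sigma_i\sigma_j,$$ where the sums run over ordered pairs $(i,j)$, and the Gibbs measure is $\mu_{N,\alpha,\beta,S}(\sigma)=e^{-H_{N,\alpha,\beta,S}(\sigma)}/\sum_{\sigma'}e^{-H_{N,\alpha,\beta,S}(\sigma')}$. *)

(* Defs.v *)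
From HB Require Import structures.
From mathcomp Require Import all_boot all_order all_algebra.
From mathcomp Require Import all_classical all_reals all_analysis.
Set Implicit Arguments. Unset Strict Implicit. Unset Printing Implicit Defensive.
Import Order.TTheory GRing.Theory Num.Theory.
Import numFieldNormedType.Exports.
Local Open Scope classical_set_scope.
Local Open Scope ring_scope.

Section BlockSpin.
Variable R : realType.

Definition spin (b : bool) : R := if b then 1 else -1.

Definition same_block N (S : {set 'I_N}) (i j : 'I_N) : bool :=
  (i \in S) == (j \in S).

Definition block_H N (alpha beta : R) (S : {set 'I_N})
    (sigma : {ffun 'I_N -> bool}) : R :=
  - (beta / (2 * N%:R)) *
      (\sum_(i < N) \sum_(j < N | same_block S i j) spin (sigma i) * spin (sigma j))
  - (alpha / (2 * N%:R)) *
      (\sum_(i < N) \sum_(j < N | ~~ same_block S i j) spin (sigma i) * spin (sigma j)).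

Definition block_Z N alpha beta S : R :=
  \sum_(sigma : {ffun 'I_N -> bool}) expR (- block_H alpha beta S sigma).

Definition gibbs N alpha beta S (sigma : {ffun 'I_N -> bool}) : R :=
  expR (- block_H alpha beta S sigma) / block_Z alpha beta S.

Definition gibbs_E N alpha beta S (F : {ffun 'I_N -> bool} -> R) : R :=
  \sum_(sigma : {ffun 'I_N -> bool}) F sigma * gibbs alpha beta S sigma.

Definition mag1 N (S : {set 'I_N}) (sigma : {ffun 'I_N -> bool}) : R :=
  (2 / N%:R) * \sum_(i in S) spin (sigma i).
Definition mag2 N (S : {set 'I_N}) (sigma : {ffun 'I_N -> bool}) : R :=
  (2 / N%:R) * \sum_(i in ~: S) spin (sigma i).

(* Convergence in distribution: X_n (given through its law functional
   f |-> E_n[f(X_n)]) converges in distribution to the law whose expectation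
   functional is L, i.e. E_n[f(X_n)] -> L f for every bounded continuous f. *)
Definition cvg_in_law (E : nat -> (R -> R) -> R) (L : (R -> R) -> R) : Prop :=
  forall f : R -> R, continuous f -> (exists M : R, forall x, `|f x| <= M) ->
    E n f @[n --> \oo] --> L f.

Definition gauss_law (v : R) (f : R -> R) : R :=
  \int[normal_prob 0 (Num.sqrt v)]_(x in [set: R]) f x.

Definition rho_K : R :=
  \int[@lebesgue_measure R]_(x in [set: R]) expR (- (x ^+ 4) / 12).
Definition rho_density (x : R) : R := expR (- (x ^+ 4) / 12) / rho_K.

Definition rho_law (f : R -> R) : R :=
  \int[@lebesgue_measure R]_(x in [set: R]) (f x * rho_density x).

End BlockSpin.

Arguments mag1 {R N}.
Arguments mag2 {R N}.
Arguments gibbs_E {R N}.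
Arguments rho_law {R}.

(* Main.v *)
Require Import Defs.
From HB Require Import structures.
From mathcomp Require Import all_boot all_order all_algebra.
From mathcomp Require Import all_classical all_reals all_analysis.
From mathcomp Require Import measurable_realfun ring lra zify.
Import Order.TTheory GRing.Theory Num.Theory.
Import numFieldNormedType.Exports.
Local Open Scope classical_set_scope.
Local Open Scope ring_scope.

(** With A and D the sum and the difference of the two block spins,
    -H = ((beta + alpha) / 2 * A^2 + (beta - alpha) / 2 * D^2) / (2 N), and one
    of the two coefficients equals 1, the critical value.  Flipping the spins of
    one block exchanges A and D, so only alpha > 0 matters, where the pair (A, D)
    lives on the scales N^(3/4) and N^(1/2).

    The block spins have binomial laws, whose logarithm is, up to an additive
    constant, a quadratic minus a quartic term with an explicit error (the ratio
    of consecutive binomial coefficients is (M - h) / (M + h)).  At criticality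
    the quadratic term in A cancels, leaving exp(- x^4 / 12 - alpha y^2 / 2) for
    x = A / N^(3/4) and y = D / N^(1/2).  The partition sum, rescaled, is the
    integral of a step function on the plane; dominated convergence and Fubini
    give the joint limit, and the normalising constants cancel in the quotient. *)

(** * Logarithms of binomial coefficients *)

Lemma is_derive_ge0_le {R : realType} (f df : R -> R) (b : R) : 0 <= b ->
  (forall t, 0 <= t <= b -> is_derive t 1 f (df t)) ->
  (forall t, 0 <= t <= b -> 0 <= df t) -> f 0 <= f b.
Proof.
move=> b0 fdf df0.
apply: (@ger0_derive1_ndecr R f 0 b) => //.
- move=> t; rewrite in_itv/= => /andP[t0 tb].
  by have [] : is_derive t 1 f (df t) by apply: fdf; rewrite !ltW.
- move=> t; rewrite in_itv/= => /andP[t0 tb].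
  have tb' : 0 <= t <= b by rewrite !ltW.
  by rewrite derive1E; have := fdf t tb' => -[_ ->]; exact: df0.
- apply: derivable_within_continuous => t; rewrite in_itv/= => tb.
  by have [] := fdf t tb.
Qed.

Lemma is_derive_ln_sub {R : realType} (t : R) : 0 <= t < 1 ->
  is_derive t 1 (fun x : R => ln (1 - x) - ln (1 + x))
    (- (1 - t)^-1 - (1 + t)^-1).
Proof.
move=> /andP[t0 t1].
have h1 : is_derive t 1 (fun x : R => ln (1 - x)) (- (1 - t)^-1).
  have d1 : is_derive (1 - t) 1 (@ln R) (1 - t)^-1.
    by apply: is_derive1_ln; rewrite subr_gt0.
  have d2 : is_derive t 1 (fun x : R => 1 - x) (-1).
    by rewrite -[-1]sub0r; apply: is_deriveB.
  by rewrite -[- _]mulrN1; exact: (@is_derive1_comp _ (@ln R) (fun x : R => 1 - x)).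
have h2 : is_derive t 1 (fun x : R => ln (1 + x)) ((1 + t)^-1).
  have d1 : is_derive (1 + t) 1 (@ln R) (1 + t)^-1.
    by apply: is_derive1_ln; lra.
  have d2 : is_derive t 1 (fun x : R => 1 + x) 1.
    have := is_deriveD (is_derive_cst (1 : R) t 1) (is_derive_id t (1 : R)).
    by rewrite add0r.
  by rewrite -[_^-1]mulr1; exact: (@is_derive1_comp _ (@ln R) (fun x : R => 1 + x)).
exact: is_deriveB.
Qed.

Lemma is_derive_monomial {R : realType} (t c : R) n :
  is_derive t 1 (fun x : R => c * x ^+ n.+1) (c * n.+1%:R * t ^+ n).
Proof.
have := is_deriveZ c (is_deriveX n.+1 (is_derive_id t (1 : R))).
rewrite (_ : c \*: _ = (fun x : R => c * x ^+ n.+1)).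
  by rewrite /GRing.scale/= mulr1 mulrA.
by apply/funext => x; rewrite exprfctE.
Qed.

(** The right side minus the left vanishes at 0 and has derivative
    [2 * t ^+ 4 / ((1 - t) * (1 + t))], which is nonnegative. *)
Lemma ln_ratio_le {R : realType} (x : R) : 0 <= x < 1 ->
  ln (1 - x) - ln (1 + x) <= - (2 * x) - 2 / 3 * x ^+ 3.
Proof.
move=> /andP[x0 x1].
pose f (x : R) : R := (-2 * x ^+ 1 + - (2 / 3) * x ^+ 3) -
   (ln (1 - x) - ln (1 + x)).
pose df (t : R) : R := (-2 * 1 * t ^+ 0 + - (2 / 3) * 3 * t ^+ 2) -
  (- (1 - t)^-1 - (1 + t)^-1).
have : f 0 <= f x.
  apply: (@is_derive_ge0_le R f df x x0).
  - move=> t /andP[t0 tx].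
    apply: is_deriveB; last by apply: is_derive_ln_sub; lra.
    by apply: is_deriveD; exact: is_derive_monomial.
  - move=> t /andP[t0 tx].
    have -> : df t = 2 * t ^+ 4 / ((1 - t) * (1 + t)).
      by rewrite /df; field; apply/andP; split; lra.
    by rewrite divr_ge0 ?mulr_ge0 ?exprn_ge0//; lra.
rewrite /f !subr0 addr0 ln1 subrr expr0n/= !mulr0. lra.
Qed.

(** The next Taylor coefficient is 2/5; taking 1 instead leaves the factor [3 - 5 * t ^+ 2] in the
    derivative of the difference, positive for [t <= 1 / 2]. *)
Lemma ln_ratio_ge {R : realType} (x : R) : 0 <= x <= 1 / 2 ->
  - (2 * x) - 2 / 3 * x ^+ 3 - x ^+ 5 <= ln (1 - x) - ln (1 + x).
Proof.
move=> /andP[x0 x1].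
pose f (x : R) : R := (ln (1 - x) - ln (1 + x)) -
  (-2 * x ^+ 1 + - (2 / 3) * x ^+ 3 + -1 * x ^+ 5).
pose df (t : R) : R := (- (1 - t)^-1 - (1 + t)^-1) -
  (-2 * 1 * t ^+ 0 + - (2 / 3) * 3 * t ^+ 2 + -1 * 5 * t ^+ 4).
have : f 0 <= f x.
  apply: (@is_derive_ge0_le R f df x x0).
  - move=> t /andP[t0 tx].
    apply: is_deriveB; first by apply: is_derive_ln_sub; lra.
    by apply: is_deriveD; [apply: is_deriveD|]; exact: is_derive_monomial.
  - move=> t /andP[t0 tx].
    have -> : df t = t ^+ 4 * (3 - 5 * t ^+ 2) / ((1 - t) * (1 + t)).
      by rewrite /df; field; apply/andP; split; lra.
    by rewrite divr_ge0 ?mulr_ge0 ?exprn_ge0//; nra.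
rewrite /f !subr0 addr0 ln1 subrr expr0n/= !mulr0. lra.
Qed.

Section binomial_profile.
Variable R : realType.

(* The coefficients are chosen so that the increment over [h - 1, h + 1] is
   exactly the cubic Taylor polynomial of ln (1 - x) - ln (1 + x) at x = h / M. *)
Definition logbin_profile (M k : R) : R :=
  - (k ^+ 2 / (2 * M)) - k ^+ 4 / (12 * M ^+ 3) + k ^+ 2 / (6 * M ^+ 3).

Lemma logbin_profile_step (M h : R) : 0 < M ->
  logbin_profile M (h + 1) - logbin_profile M (h - 1) =
  - (2 * (h / M)) - 2 / 3 * (h / M) ^+ 3.
Proof. by move=> M0; rewrite /logbin_profile; field; rewrite gt_eqF. Qed.

(** The ratio of consecutive coefficients is (n - i) / (i + 1) = (1 - x) / (1 + x). Here x = h / M,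
    where h is the midpoint of the two successive values of [2 * i - n] and M = n + 1. *)
Lemma ln_bin_step n i : (i < n)%N ->
  let x : R := (2 * i%:R - n%:R + 1) / (n%:R + 1) in
  ln 'C(n, i.+1)%:R = ln 'C(n, i)%:R + (ln (1 - x) - ln (1 + x)).
Proof.
move=> ltin x.
have n0 : 0 < n%:R + 1 :> R by rewrite ltr_wpDl.
have xm : 1 - x = (2 * (n - i)%:R) / (n%:R + 1).
  by rewrite /x natrB ?(ltnW ltin)//; field; rewrite gt_eqF.
have xp : 1 + x = (2 * i.+1%:R) / (n%:R + 1).
  by rewrite /x -natr1; field; rewrite gt_eqF.
have xm0 : 0 < 1 - x by rewrite xm divr_gt0// mulr_gt0// ltr0n subn_gt0.
have xp0 : 0 < 1 + x by rewrite xp divr_gt0// mulr_gt0.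
have c0 : 0 < 'C(n, i)%:R :> R by rewrite ltr0n bin_gt0 ltnW.
rewrite -ln_div ?posrE// -lnM ?posrE ?divr_gt0//; congr ln.
rewrite xm xp.
have : (i.+1%:R * 'C(n, i.+1)%:R = (n - i)%:R * 'C(n, i)%:R :> R).
  by rewrite -!natrM mul_bin_left.
move=> e.
have i0 : i.+1%:R != 0 :> R by rewrite pnatr_eq0.
apply: (mulfI i0); rewrite e.
rewrite natrB ?(ltnW ltin)// -natr1; field.
have i1 : i%:R + 1 != 0 :> R by rewrite natr1.
by rewrite i1 gt_eqF.
Qed.

(** One constant [c] serves both bounds and every [i], so that it can cancel between numerator and
    denominator later. The upper bound is global, as domination requires; the lower one is only
    wanted near the centre. *)
Lemma ln_bin_bounds n : exists c : R, forall i, (i <= n)%N ->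
  let k : R := 2 * i%:R - n%:R in let M : R := n%:R + 1 in
  ln 'C(n, i)%:R <= c + logbin_profile M k /\
  (`|k| <= M / 2 -> c + logbin_profile M k - k ^+ 6 / M ^+ 5 <= ln 'C(n, i)%:R).
Proof.
pose i0 := uphalf n; pose M : R := n%:R + 1.
have M0 : 0 < M by rewrite ltr_wpDl.
pose c : R := ln 'C(n, i0)%:R - logbin_profile M (2 * i0%:R - n%:R).
exists c.
have key m : (i0 + m <= n)%N -> let k : R := 2 * (i0 + m)%:R - n%:R in
  ln 'C(n, i0 + m)%:R <= c + logbin_profile M k /\
  (`|k| <= M / 2 -> c + logbin_profile M k - k ^+ 6 / M ^+ 5 <= ln 'C(n, i0 + m)%:R).
  elim: m => [|m IH] le_m k.
    rewrite /k addn0 /c subrK; split => // _.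
    by rewrite gerBl divr_ge0 ?(@exprn_even_ge0 _ 6)// exprn_ge0// ltW.
  have lt_m : (i0 + m < n)%N by rewrite -addnS.
  have [IHu IHl] := IH (ltnW lt_m).
  rewrite addnS ln_bin_step//.
  set k' : R := 2 * (i0 + m)%:R - n%:R in IHu IHl *.
  have kk' : k = k' + 2 by rewrite /k addnS -natr1 /k'; ring.
  pose h := k' + 1.
  have k'0 : 0 <= k'.
    rewrite /k' subr_ge0 -natrM ler_nat /i0. lia.
  have hM : h < M.
    rewrite /h /M ltrD2r /k' ltrBlDr -natrM -natrD ltr_nat. lia.
  have h0 : 0 < h by rewrite ltr_wpDl.
  have := logbin_profile_step _ h M0.
  have h1 : h + 1 = k by rewrite kk' /h; ring.
  have hN1 : h - 1 = k' by rewrite /h; ring.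
  rewrite h1 hN1 => st.
  split.
    have hM1 : 0 <= h / M < 1.
      by rewrite ltr_pdivrMr// mul1r hM andbT divr_ge0 ?(ltW h0) ?(ltW M0).
    have := ln_ratio_le (h / M) hM1.
    move: IHu st; rewrite /M -/h; lra.
  move=> kM.
  have k0 : 0 <= k by rewrite kk'; lra.
  have hk : h <= M / 2.
    by move: kM; rewrite ger0_norm// kk' /h; lra.
  have kM' : `|k'| <= M / 2 by rewrite ger0_norm//; move: hk; rewrite /h; lra.
  have hM2 : 0 <= h / M <= 1 / 2.
    rewrite ler_pdivrMr// (mulrC (1 / 2)) mulrA mulr1 hk andbT.
    by rewrite divr_ge0 ?(ltW h0) ?(ltW M0).
  have := ln_ratio_ge (h / M) hM2.
  (* The quintic error of one step is absorbed by the increment of [k ^+ 6 / M ^+ 5], so the errors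
     telescope. *)
  have : (h / M) ^+ 5 <= k ^+ 6 / M ^+ 5 - k' ^+ 6 / M ^+ 5.
    rewrite expr_div_n -mulrBl ler_pM2r ?invr_gt0 ?exprn_gt0//.
    rewrite -h1 -hN1.
    have -> : (h + 1) ^+ 6 - (h - 1) ^+ 6 = 12 * h ^+ 5 + 40 * h ^+ 3 + 12 * h by ring.
    have := exprn_ge0 5 (ltW h0); have := exprn_ge0 3 (ltW h0); lra.
  move: (IHl kM') st; rewrite /M -/h; lra.
move=> i le_in k M'.
have [i0i|ii0] := leqP i0 i.
  by have := key (i - i0)%N; rewrite subnKC//; exact.
(* The lower half follows by the symmetry [i] to [n - i], which changes the sign of [k]; only even
   powers of [k] occur. *)
have i0ni : (i0 <= n - i)%N by rewrite /i0 in ii0 *; lia.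
have := key (n - i - i0)%N; rewrite subnKC// => /(_ (leq_subr _ _)) /=.
rewrite bin_sub// natrB//.
have -> : 2 * (n%:R - i%:R) - n%:R = - k by rewrite /k; ring.
by rewrite normrN /logbin_profile !sqrrN (_ : (- k) ^+ 4 = k ^+ 4) 1?(_ : (- k) ^+ 6 = k ^+ 6)//; ring.
Qed.

End binomial_profile.

(** * Gibbs expectations as sums over block spins *)

Section counting.
Variables (R : realType) (T : finType).
Implicit Types (S : {set T}) (sigma : {ffun T -> bool}).

Lemma sum_powerset_card S (f : nat -> R) :
  \sum_(B in powerset S) f #|B| =
  \sum_(i < #|S|.+1) 'C(#|S|, i)%:R * f i.
Proof.
rewrite (partition_big (fun B : {set T} => inord #|B| : 'I_#|S|.+1) xpredT)//=.
apply: eq_bigr => i _.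
rewrite (eq_bigl (fun B : {set T} => (B \subset S) && (#|B| == i))); last first.
  move=> B; rewrite finset.powersetE; apply: andb_id2l => BS.
  by rewrite -val_eqE/= inordK// ltnS subset_leq_card.
rewrite (eq_bigr (fun=> f i)) => [|B /andP[_ /eqP->]//].
rewrite sumr_const -[LHS]mulr_natl; congr (_%:R * _).
by rewrite -cards_draws cardsE.
Qed.

(** A configuration is its set of up spins, and such a set is a pair of subsets, one of [S] and one
    of its complement. Grouping each by cardinality produces the binomial coefficients. *)
Lemma sum_spins_card S (F : nat -> nat -> R) :
  \sum_(sigma : {ffun T -> bool}) F #|S :&: [set x | sigma x]%SET| #|~: S :&: [set x | sigma x]%SET| =
  \sum_(i < #|S|.+1) \sum_(j < #|~: S|.+1)
    'C(#|S|, i)%:R * 'C(#|~: S|, j)%:R * F i j.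
Proof.
rewrite (reindex (fun A : {set T} => [ffun x => x \in A])); last first.
  exists (fun sigma : {ffun T -> bool} => [set x | sigma x]%SET) => A _.
    by apply/setP => x; rewrite inE ffunE.
  by apply/ffunP => x; rewrite ffunE inE.
transitivity (\sum_(A : {set T}) F #|S :&: A| #|~: S :&: A|).
  apply: eq_bigr => A _; rewrite (_ : [set x | _]%SET = A)//.
  by apply/setP => x; rewrite inE ffunE.
transitivity (\sum_(B in powerset S) \sum_(C in powerset (~: S)) F #|B| #|C|).
  rewrite pair_big/=.
  rewrite (reindex_omap (fun p : {set T} * {set T} => p.1 :|: p.2)
    (fun A => Some (S :&: A, ~: S :&: A))) /=; last first.
    by move=> A _; congr Some; rewrite -finset.setIUl finset.setUCr finset.setTI.
  apply: eq_big => [[B C]|[B C]] /=.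
    (* A pair is recovered from its union by intersecting with the two blocks exactly when [B] lies
       in [S] and [C] in its complement. *)
    rewrite !finset.powersetE; apply/idP/andP => [/eqP[<- <-]|[BS CS]].
      by rewrite !finset.subsetIl.
    rewrite !finset.setIUr (finset.setIidPr BS) (finset.setIidPr CS).
    rewrite (_ : S :&: C = finset.set0); last first.
      by apply/eqP; rewrite finset.setI_eq0 disjoint_sym finset.disjoints_subset.
    rewrite (_ : ~: S :&: B = finset.set0); last first.
      by apply/eqP; rewrite finset.setI_eq0 disjoint_sym finset.disjoints_subset finset.setCK.
    by rewrite finset.setU0 finset.set0U.
  by move=> /eqP[-> ->].
under eq_bigr do rewrite sum_powerset_card.
rewrite (sum_powerset_card _ (fun k => \sum_(j < #|~: S|.+1) 'C(#|~: S|, j)%:R * F k j)).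
by apply: eq_bigr => i _; rewrite mulr_sumr; apply: eq_bigr => j _; rewrite mulrA.
Qed.

Lemma sum_spin S sigma :
  \sum_(x in S) spin R (sigma x) = 2 * #|S :&: [set x | sigma x]%SET|%:R - #|S|%:R.
Proof.
rewrite (eq_bigr (fun x => 2 * (sigma x)%:R - 1)); last first.
  by move=> x _; rewrite /spin; case: (sigma x); rewrite ?mulr1 ?mulr0 ?sub0r//; ring.
rewrite big_split/= -mulr_sumr sumrN; congr (2 * _ - _); last first.
  by rewrite sumr_const.
rewrite -sumr_const [RHS]big_mkcond/= [LHS]big_mkcond/=.
apply: eq_bigr => x _; rewrite inE inE; case: (x \in S) => //=.
by case: (sigma x).
Qed.

End counting.

Section partition_sum.
Variable R : realType.

(** An unnormalised Gibbs expectation for two blocks of size [m] with [i] and [j] up spins. The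
    denominator [4 * m] is 2N. The coefficients [a] and [d] are kept separate so that the two signs
    of alpha can be exchanged. *)
Definition block_sum (m : nat) (a d : R) (F : R -> R -> R) : R :=
  \sum_(i < m.+1) \sum_(j < m.+1)
    let A : R := (2 * i%:R - m%:R) + (2 * j%:R - m%:R) in
    let D : R := (2 * i%:R - m%:R) - (2 * j%:R - m%:R) in
    'C(m, i)%:R * 'C(m, j)%:R *
    (expR ((a * A ^+ 2 + d * D ^+ 2) / (4 * m%:R)) * F A D).

(* Flipping all the spins of the second block exchanges A and D. *)
Lemma block_sumC m a d F : block_sum m a d F = block_sum m d a (fun A D => F D A).
Proof.
rewrite /block_sum; apply: eq_bigr => i _.
rewrite (reindex_inj rev_ord_inj)/=; apply: eq_bigr => j _.
rewrite subSS bin_sub -1?ltnS//.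
have jm : (j <= m)%N by rewrite -ltnS.
rewrite natrB//.
have -> : 2 * i%:R - m%:R + (2 * (m%:R - j%:R) - m%:R) =
  2 * i%:R - m%:R - (2 * j%:R - m%:R) :> R by ring.
have -> : 2 * i%:R - m%:R - (2 * (m%:R - j%:R) - m%:R) =
  2 * i%:R - m%:R + (2 * j%:R - m%:R) :> R by ring.
by rewrite (addrC (a * _)).
Qed.

Lemma eq_block_sum m a d F G : F =2 G -> block_sum m a d F = block_sum m a d G.
Proof. by move=> FG; do 2 apply: eq_bigr => ? _; rewrite /= FG. Qed.

Section gibbs.
Variables (m : nat) (S : {set 'I_(2 * m)}).
Hypothesis cardS : #|S| = m.

Let cardSC : #|~: S| = m.
Proof. by rewrite finset.cardsCs finset.setCK cardS card_ord mul2n -addnn addnK. Qed.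

(** The double sums are s1^2 + s2^2 within blocks and 2 s1 s2 across them; the resulting quadratic
    form is diagonal in s1 + s2 and s1 - s2. *)
Lemma block_H_spins (alpha beta : R) (sigma : {ffun 'I_(2 * m) -> bool}) :
  let s1 := \sum_(x in S) spin R (sigma x) in
  let s2 := \sum_(x in ~: S) spin R (sigma x) in
  - block_H alpha beta S sigma =
  ((beta + alpha) / 2 * (s1 + s2) ^+ 2 + (beta - alpha) / 2 * (s1 - s2) ^+ 2)
    / (4 * m%:R).
Proof.
move=> s1 s2.
have same : \sum_(i < 2 * m) \sum_(j < 2 * m | same_block S i j)
    spin R (sigma i) * spin R (sigma j) = s1 ^+ 2 + s2 ^+ 2.
  rewrite (bigID (fun i => i \in S))/= !expr2 {1}/s1 {2}/s2 !mulr_suml.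
  congr (_ + _).
    apply: eq_bigr => i iS; rewrite -mulr_sumr; congr (_ * _).
    by apply: eq_bigl => j; rewrite /same_block iS eq_sym eqb_id.
  apply: eq_big => [i|i iS]; first by rewrite inE.
  rewrite -mulr_sumr; congr (_ * _).
  by apply: eq_bigl => j; rewrite /same_block (negbTE iS) inE eq_sym eqbF_neg.
have diff : \sum_(i < 2 * m) \sum_(j < 2 * m | ~~ same_block S i j)
    spin R (sigma i) * spin R (sigma j) = 2 * (s1 * s2).
  rewrite (bigID (fun i => i \in S))/= mulr_natl mulr2n {2}(mulrC s1).
  rewrite {1}/s1 {2}/s2 !mulr_suml.
  congr (_ + _).
    apply: eq_bigr => i iS; rewrite -mulr_sumr; congr (_ * _).
    by apply: eq_bigl => j; rewrite /same_block iS inE eq_sym eqb_id.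
  apply: eq_big => [i|i iS]; first by rewrite inE.
  rewrite -mulr_sumr; congr (_ * _).
  by apply: eq_bigl => j; rewrite /same_block (negbTE iS) eq_sym eqbF_neg negbK.
rewrite /block_H same diff natrM.
(* For [m = 0] both sides vanish, since the inverse of 0 is 0. *)
have [->|m0] := eqVneq m 0%N; first by rewrite !mulr0 invr0 !mulr0 !mul0r; ring.
by field; rewrite pnatr_eq0.
Qed.

Lemma sum_boltzmann (alpha beta : R) (F : R -> R -> R) :
  \sum_(sigma : {ffun 'I_(2 * m) -> bool}) F (\sum_(x in S) spin R (sigma x)) (\sum_(x in ~: S) spin R (sigma x))
    * expR (- block_H alpha beta S sigma) =
  block_sum m ((beta + alpha) / 2) ((beta - alpha) / 2)
    (fun A D => F ((A + D) / 2) ((A - D) / 2)).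
Proof.
under eq_bigr do rewrite block_H_spins !sum_spin cardS cardSC.
pose G (i j : nat) : R := let s1 := 2 * i%:R - m%:R in let s2 := 2 * j%:R - m%:R in
  F s1 s2 * expR (((beta + alpha) / 2 * (s1 + s2) ^+ 2 +
    (beta - alpha) / 2 * (s1 - s2) ^+ 2) / (4 * m%:R)).
rewrite (sum_spins_card _ _ S G) cardS cardSC.
apply: eq_bigr => i _; apply: eq_bigr => j _ /=; congr (_ * _).
rewrite /G mulrC; congr (_ * F _ _); by field.
Qed.

Lemma gibbs_E_block_sum (alpha beta : R) (F : R -> R -> R) : (0 < m)%N ->
  gibbs_E alpha beta S (fun sigma => F (mag1 S sigma) (mag2 S sigma)) =
  block_sum m ((beta + alpha) / 2) ((beta - alpha) / 2)
    (fun A D => F ((A + D) / (2 * m%:R)) ((A - D) / (2 * m%:R))) /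
  block_sum m ((beta + alpha) / 2) ((beta - alpha) / 2) (fun _ _ => 1).
Proof.
move=> m0; have mn0 : m%:R != 0 :> R by rewrite pnatr_eq0 -lt0n.
have e2 : 2 / (2 * m)%:R = m%:R^-1 :> R by rewrite natrM; field.
rewrite -(sum_boltzmann alpha beta (fun _ _ => 1)).
rewrite (eq_block_sum _ _ _ _ (fun A D =>
  (fun s1 s2 => F (m%:R^-1 * s1) (m%:R^-1 * s2)) ((A + D) / 2) ((A - D) / 2))); last first.
  by move=> A D /=; congr F; field.
rewrite -(sum_boltzmann alpha beta (fun s1 s2 => F (m%:R^-1 * s1) (m%:R^-1 * s2))).
rewrite /gibbs_E /gibbs /block_Z mulr_suml; apply: eq_bigr => sigma _.
rewrite /mag1 /mag2 e2 mulrA; congr (_ / _).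
by apply: eq_bigr => ? _; rewrite mul1r.
Qed.

End gibbs.
End partition_sum.

(** * The limit laws *)

Section product_integral.
Context d1 d2 (T1 : measurableType d1) (T2 : measurableType d2) (R : realType).
Variables (m1 : {sigma_finite_measure set T1 -> \bar R})
          (m2 : {sigma_finite_measure set T2 -> \bar R}).
Variables (p : T1 -> R) (q : T2 -> R).
Hypothesis ip : m1.-integrable setT (EFin \o p).
Hypothesis iq : m2.-integrable setT (EFin \o q).

Let mp : measurable_fun setT p.
Proof. by apply/measurable_EFinP; exact: measurable_int ip. Qed.

Let mq : measurable_fun setT q.
Proof. by apply/measurable_EFinP; exact: measurable_int iq. Qed.

(** By Tonelli it suffices that the iterated integral of the absolute value is finite, and this one
    factorises. *)
Lemma integrable_prod_mul :
  (m1 \x m2)%E.-integrable setT (fun z => (p z.1 * q z.2)%:E).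
Proof.
have mpq : measurable_fun setT (fun z : T1 * T2 => (p z.1 * q z.2)%:E).
  apply/measurable_EFinP; apply: measurable_funM.
    exact: measurableT_comp.
  exact: measurableT_comp.
apply/integrable12ltyP => //=.
have /integrableP[_ fq] := iq; have /integrableP[_ fp] := ip.
under eq_integral => x _.
  under eq_integral do rewrite normrM EFinM.
  rewrite ge0_integralZl//=; first over.
  by apply/measurable_EFinP; exact: measurableT_comp.
rewrite ge0_integralZr//=.
- apply: lte_mul_pinfty => //; first exact: integral_ge0.
  by rewrite ge0_fin_numE//; exact: integral_ge0.
- by apply/measurable_EFinP; exact: measurableT_comp.
- exact: integral_ge0.
Qed.

Lemma integral_prod_mul :
  (\int[m1 \x m2]_z (p z.1 * q z.2)%:E =
   (\int[m1]_x (p x)%:E) * \int[m2]_y (q y)%:E)%E.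
Proof.
rewrite -(integral12_prod_meas1 integrable_prod_mul).
rewrite /fubini_F/=.
under eq_integral => x _.
  under eq_integral do rewrite EFinM.
  rewrite integralZl//; over.
have fq : (\int[m2]_y (q y)%:E)%E \is a fin_num by exact: integrable_fin_num.
rewrite -(fineK fq) integralZr//.
Qed.

End product_integral.

Section gaussian.
Variable R : realType.
Notation mu := (@lebesgue_measure R).

(** The parameter is the inverse variance, the form in which alpha enters the limiting weight. Its
    positivity excludes the degenerate branch of [normal_pdf]. *)
Lemma normal_pdf0E (c x : R) : 0 < c ->
  normal_pdf 0 (Num.sqrt c^-1) x =
  normal_peak (Num.sqrt c^-1) * expR (- (c * x ^+ 2) / 2).
Proof.
move=> c0; rewrite /normal_pdf ifF; last first.
  by rewrite gt_eqF// sqrtr_gt0 invr_gt0.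
rewrite /normal_fun subr0 sqr_sqrtr ?invr_ge0 ?ltW//.
by congr (_ * expR _); rewrite -[_ *+ 2]mulr_natr; field; rewrite gt_eqF.
Qed.

Lemma integrable_gaussian (c : R) : 0 < c ->
  mu.-integrable setT (EFin \o (fun x => expR (- (c * x ^+ 2) / 2))).
Proof.
move=> c0.
have p0 : normal_peak (Num.sqrt c^-1) != 0.
  by rewrite gt_eqF// normal_peak_gt0// gt_eqF// sqrtr_gt0 invr_gt0.
have := integrableZl measurableT (normal_peak (Num.sqrt c^-1))^-1
  (integrable_normal_pdf 0 (Num.sqrt c^-1)).
apply: eq_integrable => // x _.
by rewrite /= normal_pdf0E// -EFinM mulKf.
Qed.

Lemma integral_gaussian_gt0 (c : R) : 0 < c ->
  0 < \int[mu]_x expR (- (c * x ^+ 2) / 2).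
Proof.
move=> c0; set s := Num.sqrt c^-1.
have p0 : 0 < normal_peak s.
  by rewrite normal_peak_gt0// gt_eqF// sqrtr_gt0 invr_gt0.
have := congr1 fine (integral_normal_pdf 0 s).
under eq_integral do rewrite normal_pdf0E//.
rewrite -[LHS]/(\int[mu]_x (normal_peak s * expR (- (c * x ^+ 2) / 2))) /=.
rewrite RintegralZl//; last exact: integrable_gaussian.
by move=> e; rewrite -(pmulr_rgt0 _ p0) e ltr01.
Qed.

(** The Radon-Nikodym derivative with respect to Lebesgue measure agrees almost everywhere with the
    density, both having the same integral over every measurable set. *)
Lemma integral_normal_prob (m s : R) (f : measurableTypeR R -> \bar R) :
  (normal_prob m s).-integrable setT f ->
  (\int[normal_prob m s]_x f x = \int[mu]_x (f x * (normal_pdf m s x)%:E))%E.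
Proof.
move=> intf.
have mf : measurable_fun setT f by exact: measurable_int intf.
rewrite -(Radon_Nikodym_change_of_variables (normal_prob_dominates m s))//=.
apply: ae_eq_integral => //.
- apply: emeasurable_funM => //; apply: (measurable_int mu).
  by apply: Radon_Nikodym_integrable; exact: normal_prob_dominates.
- apply: emeasurable_funM => //=; apply/measurableT_comp => //=.
  exact: measurable_normal_pdf.
- apply: ae_eqe_mul2l => /=.
  rewrite Radon_NikodymE//=; first exact: normal_prob_dominates.
  move=> nmu; case: cid => /= h [h1 h2 h3].
  apply: integral_ae_eq => //=.
    by apply/measurable_EFinP; exact: measurable_normal_pdf.
  by move=> E _ mE; rewrite -h3.
Qed.

Lemma integrableM_bounded (f p : R -> R) : continuous f ->
  (exists M, forall x, `|f x| <= M) -> mu.-integrable setT (EFin \o p) ->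
  mu.-integrable setT (EFin \o (fun x => f x * p x)).
Proof.
move=> cf [B fB] ip.
have mf : measurable_fun setT f by exact: continuous_measurable_fun.
have mp : measurable_fun setT p.
  by apply/measurable_EFinP; exact: measurable_int ip.
apply: (le_integrable _ _ _ (integrableZl measurableT B ip)) => //.
  by apply/measurable_EFinP; exact: measurable_funM.
move=> x _ /=; rewrite lee_fin !normrM ler_wpM2r//.
exact: le_trans (fB x) (ler_norm _).
Qed.

(** The quotient form hides the normalising constant and matches the limit of a ratio of two
    partition sums. *)
Lemma gauss_lawE (c : R) (f : R -> R) : 0 < c -> continuous f ->
  (exists M, forall x, `|f x| <= M) ->
  gauss_law c^-1 f = (\int[mu]_x (f x * expR (- (c * x ^+ 2) / 2))) /
    \int[mu]_x expR (- (c * x ^+ 2) / 2).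
Proof.
move=> c0 cf bf; set s := Num.sqrt c^-1.
have mf : measurable_fun setT f by exact: continuous_measurable_fun.
have ig := integrable_gaussian _ c0.
have p0 : 0 < normal_peak s.
  by rewrite normal_peak_gt0// gt_eqF// sqrtr_gt0 invr_gt0.
have K : normal_peak s * \int[mu]_x expR (- (c * x ^+ 2) / 2) = 1.
  rewrite -RintegralZl//.
  rewrite -[RHS](congr1 fine (integral_normal_pdf 0 s)); congr fine.
  by apply: eq_integral => x _; rewrite normal_pdf0E.
(* The side goal is integrability of [f] under the Gaussian law: it is bounded by a constant and the
   total mass is 1. *)
rewrite /gauss_law /Rintegral integral_normal_prob; last first.
  apply/integrableP; split; first exact/measurable_EFinP.
  have [B fB] := bf.
  apply: (@le_lt_trans _ _ (\int[normal_prob 0 s]_x (cst B%:E x))%E).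
    apply: ge0_le_integral => //.
    - by apply: measurableT_comp => //; exact/measurable_EFinP.
    - by move=> x _; rewrite lee_fin.
  rewrite integral_cst//. 
  by rewrite [X in (_ * X)%E]integral_normal_pdf mule1 ltry.
have -> : fine (\int[mu]_x ((f x)%:E * (normal_pdf 0 s x)%:E)) =
   \int[mu]_x (normal_peak s * (f x * expR (- (c * x ^+ 2) / 2))).
  congr fine; apply: eq_integral => x _.
  by rewrite normal_pdf0E// -EFinM mulrCA.
rewrite RintegralZl//; last exact: integrableM_bounded.
apply: (mulIf (lt0r_neq0 (integral_gaussian_gt0 _ c0))).
by rewrite divfK ?(lt0r_neq0 (integral_gaussian_gt0 _ c0))// mulrAC K mul1r.
Qed.

(** Since x^4 >= 2 x^2 - 1, the function is at most e times the Gaussian exp(- x^2 / 6). *)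
Lemma integrable_quartic :
  mu.-integrable setT (EFin \o (fun x => expR (- (x ^+ 4) / 12))).
Proof.
have := integrableZl measurableT (expR 1) (integrable_gaussian (1 / 3) ltac:(lra)).
apply: le_integrable => //.
  apply/measurable_EFinP; apply: measurableT_comp => //.
  apply: measurable_funM => //.
  by apply: (@measurableT_comp _ _ _ _ _ _ (@GRing.opp R)) => //; exact: exprn_measurable.
move=> x _ /=; rewrite lee_fin !ger0_norm ?mulr_ge0 ?expR_ge0//.
rewrite -expRD ler_expR.
have -> : x ^+ 4 = (x ^+ 2) ^+ 2 by ring.
have := sqr_ge0 (x ^+ 2 - 1); nra.
Qed.

(** On the unit interval the integrand is at least exp(- 1 / 12). *)
Lemma rho_K_gt0 : 0 < rho_K R.
Proof.
rewrite /rho_K; set p := fun x : R => expR (- (x ^+ 4) / 12).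
have : 0 < \int[mu]_(x in `[0, 1]) expR (- 1 / 12).
  by rewrite Rintegral_cst//= lebesgue_measure_itv/= lte01 sube0 mulr1 expR_gt0.
move=> /lt_le_trans; apply.
have le01 : \int[mu]_(x in `[0, 1]) expR (- 1 / 12) <= \int[mu]_(x in `[0, 1]) p x.
  apply: le_Rintegral => //.
  - apply: continuous_compact_integrable; first exact: segment_compact.
    by apply: continuous_subspaceT => ?; exact: cvg_cst.
  - exact: integrableS integrable_quartic.
  - move=> x; rewrite /= in_itv/= => /andP[x0 x1].
    by rewrite ler_expR ler_pM2r ?invr_gt0// lerN2 exprn_ile1.
apply: le_trans le01 _.
rewrite /Rintegral fine_le//.
- apply: integrable_fin_num => //; exact: integrableS integrable_quartic.
- apply: integrable_fin_num => //; exact: integrable_quartic.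
apply: ge0_subset_integral => //.
- by have /integrableP[] := integrable_quartic.
- by move=> x _; rewrite lee_fin expR_ge0.
Qed.

Lemma rho_lawE (f : R -> R) : continuous f -> (exists M, forall x, `|f x| <= M) ->
  rho_law f = (\int[mu]_x (f x * expR (- (x ^+ 4) / 12))) /
    \int[mu]_x expR (- (x ^+ 4) / 12).
Proof.
move=> cf bf; rewrite /rho_law /rho_density.
under eq_Rintegral do rewrite mulrA.
by rewrite RintegralZr//; exact: integrableM_bounded integrable_quartic.
Qed.

End gaussian.

(** * Local asymptotics of the Gibbs weights *)

Section weight.
Variable R : realType.
Implicit Types (alpha t x y r : R).

(* The logarithm of the Gibbs weight at A = x r^3, D = y r^2 with the profile
   in place of the binomial coefficients, where r = N^(1/4) and t = 1 / r;
   see [rescaled_exponentE]. *)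
Definition rescaled_exponent alpha t x y : R :=
  - (alpha * y ^+ 2) / 2 + (x ^+ 2 * t ^+ 2 + y ^+ 2 * t ^+ 4) / (1 + 2 * t ^+ 4)
  - (x ^+ 4 + 6 * x ^+ 2 * y ^+ 2 * t ^+ 2 + y ^+ 4 * t ^+ 4) /
      (12 * (1 + 2 * t ^+ 4) ^+ 3)
  + 2 / 3 * (x ^+ 2 * t ^+ 6 + y ^+ 2 * t ^+ 8) / (1 + 2 * t ^+ 4) ^+ 3.

(** The critical cancellation: the profiles contribute - A^2 / (4 (m + 1)) against A^2 / (4 m),
    leaving only A^2 / (4 m (m + 1)). With t = 1 / r, the factor [1 + 2 * t ^+ 4] is (m + 1) / m. *)
Lemma rescaled_exponentE alpha r m x y : 0 < r -> r ^+ 4 = 2 * m%:R ->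
  logbin_profile R (m%:R + 1) ((x * r ^+ 3 + y * r ^+ 2) / 2) +
  logbin_profile R (m%:R + 1) ((x * r ^+ 3 - y * r ^+ 2) / 2) +
  (1 * (x * r ^+ 3) ^+ 2 + (1 - alpha) * (y * r ^+ 2) ^+ 2) / (4 * m%:R) =
  rescaled_exponent alpha r^-1 x y.
Proof.
move=> r0 r4.
have -> : m%:R = r ^+ 4 / 2 by rewrite r4; field.
rewrite /logbin_profile /rescaled_exponent.
have r40 : 0 < r ^+ 4 by rewrite exprn_gt0.
field.
do ?[apply/andP; split]; rewrite ?gt_eqF//; nra.
Qed.

(** A bound uniform in [r], for domination. The ranges of [x] and [y] express that A and D are at
    most N in absolute value. The denominator 96 is 12 * 8, as [(1 + 2 * t ^+ 4) ^+ 3 <= 8], and 3 =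
    2 + 1 bounds the two positive corrections. *)
Lemma rescaled_exponent_le alpha r x y : 0 < r -> 2 <= r ^+ 4 ->
  `|x| <= r -> `|y| <= r ^+ 2 ->
  rescaled_exponent alpha r^-1 x y <= 3 - x ^+ 4 / 96 - alpha * y ^+ 2 / 2.
Proof.
move=> r0 r4 xr yr; rewrite /rescaled_exponent; set t := r^-1.
have t0 : 0 < t by rewrite invr_gt0.
have sqr_le1 (z : R) : `|z| <= 1 -> z ^+ 2 <= 1.
  by move=> z1; rewrite -real_normK ?num_real// exprn_ile1.
have xt : x ^+ 2 * t ^+ 2 <= 1.
  rewrite -exprMn; apply: sqr_le1.
  by rewrite normrM (gtr0_norm t0) ler_pdivrMr// mul1r.
have yt : y ^+ 2 * t ^+ 4 <= 1.
  have -> : y ^+ 2 * t ^+ 4 = (y * t ^+ 2) ^+ 2 by ring.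
  apply: sqr_le1; rewrite normrM (ger0_norm (exprn_ge0 2 (ltW t0))) exprVn.
  by rewrite ler_pdivrMr ?exprn_gt0// mul1r.
have t4 : t ^+ 4 <= 1 / 2.
  by rewrite exprVn mul1r lef_pV2 ?posrE ?exprn_gt0.
have t40 : 0 < t ^+ 4 by rewrite exprn_gt0.
set s := t ^+ 4 in t4 t40 yt *.
have x2 := sqr_ge0 x; have y2 := sqr_ge0 y; have t2 := sqr_ge0 t.
have xt0 : 0 <= x ^+ 2 * t ^+ 2 by exact: mulr_ge0.
have yt0 : 0 <= y ^+ 2 * s by rewrite mulr_ge0// ltW.
have D1 : 1 <= 1 + 2 * s by lra.
have D3 : 1 <= (1 + 2 * s) ^+ 3 by rewrite exprn_ege1.
have D8 : (1 + 2 * s) ^+ 3 <= 8.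
  have -> : 8 = 2 ^+ 3 :> R by ring.
  by rewrite lerXn2r ?nnegrE; lra.
have e1 : (x ^+ 2 * t ^+ 2 + y ^+ 2 * s) / (1 + 2 * s) <= 2.
  by rewrite ler_pdivrMr; lra.
have e2 : x ^+ 4 / 96 <=
    (x ^+ 4 + 6 * x ^+ 2 * y ^+ 2 * t ^+ 2 + y ^+ 4 * s) / (12 * (1 + 2 * s) ^+ 3).
  apply: (@le_trans _ _ (x ^+ 4 / (12 * (1 + 2 * s) ^+ 3))).
    rewrite ler_wpM2l ?(@exprn_even_ge0 _ 4)// lef_pV2 ?posrE//; lra.
  rewrite ler_wpM2r ?invr_ge0//; first lra.
  have : 0 <= x ^+ 2 * t ^+ 2 * y ^+ 2 by exact: mulr_ge0.
  have : 0 <= y ^+ 4 * s by rewrite mulr_ge0 ?(@exprn_even_ge0 _ 4)// ltW.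
  lra.
have e3 : 2 / 3 * (x ^+ 2 * t ^+ 6 + y ^+ 2 * t ^+ 8) / (1 + 2 * s) ^+ 3 <= 1.
  rewrite ler_pdivrMr; last lra.
  have -> : x ^+ 2 * t ^+ 6 = x ^+ 2 * t ^+ 2 * s by rewrite /s; ring.
  have -> : y ^+ 2 * t ^+ 8 = y ^+ 2 * s * s by rewrite /s; ring.
  have : x ^+ 2 * t ^+ 2 * s <= 1 * (1 / 2) by rewrite ler_pM// ltW.
  have : y ^+ 2 * s * s <= 1 * (1 / 2) by rewrite ler_pM// ltW.
  lra.
lra.
Qed.

(* A / r^3 and D / r^2 when i and j spins are up in the two blocks of size m. *)
Definition magx r m (i j : nat) : R :=
  ((2 * i%:R - m%:R) + (2 * j%:R - m%:R)) / r ^+ 3.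
Definition magy r m (i j : nat) : R :=
  ((2 * i%:R - m%:R) - (2 * j%:R - m%:R)) / r ^+ 2.

(** The factor [expR (- (2 * c))] removes the additive constant of both binomial logarithms; being
    independent of [i] and [j], it cancels in Gibbs expectations. *)
Definition cell_weight alpha (c : R) m (i j : nat) : R :=
  let A : R := (2 * i%:R - m%:R) + (2 * j%:R - m%:R) in
  let D : R := (2 * i%:R - m%:R) - (2 * j%:R - m%:R) in
  expR (- (2 * c)) *
  ('C(m, i)%:R * 'C(m, j)%:R * expR ((1 * A ^+ 2 + (1 - alpha) * D ^+ 2) / (4 * m%:R))).

Lemma cell_weight_bounds m : exists c : R, forall alpha r i j,
  (0 < m)%N -> 0 < r -> r ^+ 4 = 2 * m%:R -> (i <= m)%N -> (j <= m)%N ->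
  let x := magx r m i j in let y := magy r m i j in let t := r^-1 in
  cell_weight alpha c m i j <= expR (rescaled_exponent alpha t x y) /\
  (t * (`|x| + `|y| * t) <= 1 / 2 ->
   expR (rescaled_exponent alpha t x y - t ^+ 2 * (`|x| + `|y| * t) ^+ 6)
     <= cell_weight alpha c m i j).
Proof.
have [c cP] := ln_bin_bounds R m; exists c => alpha r i j m0 r0 r4 im jm x y t.
have [ui li] := cP i im; have [uj lj] := cP j jm.
have ci : 0 < 'C(m, i)%:R :> R by rewrite ltr0n bin_gt0.
have cj : 0 < 'C(m, j)%:R :> R by rewrite ltr0n bin_gt0.
have r30 : r ^+ 3 != 0 by rewrite gt_eqF// exprn_gt0.
have r20 : r ^+ 2 != 0 by rewrite gt_eqF// exprn_gt0.
have ki : 2 * i%:R - m%:R = (x * r ^+ 3 + y * r ^+ 2) / 2.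
  by rewrite /x /y /magx /magy !divfK//; field.
have kj : 2 * j%:R - m%:R = (x * r ^+ 3 - y * r ^+ 2) / 2.
  by rewrite /x /y /magx /magy !divfK//; field.
rewrite -(@rescaled_exponentE alpha r m)// -ki -kj.
have -> : cell_weight alpha c m i j = expR (
    (ln 'C(m, i)%:R - c) + (ln 'C(m, j)%:R - c) +
  (1 * (x * r ^+ 3) ^+ 2 + (1 - alpha) * (y * r ^+ 2) ^+ 2) / (4 * m%:R)).
  rewrite /cell_weight !expRD !lnK ?posrE// /x /y /magx /magy !divfK//.
  rewrite (_ : - (2 * c) = - c - c); last by ring.
  by rewrite expRD; ring.
rewrite !ler_expR; split.
  by rewrite lerD2r lerD// lerBlDl.
move=> small.
(* The sign [e] treats both blocks at once: 1 for the first, -1 for the second. *)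
have kbound (e : R) : `|e| = 1 -> `|(x * r ^+ 3 + e * y * r ^+ 2) / 2| <= (m%:R + 1) / 2.
  move=> e1.
  rewrite normrM normfV (@ger0_norm _ 2)// ler_pM2r ?invr_gt0//.
  apply: (@le_trans _ _ ((`|x| + `|y| * t) * r ^+ 3)).
    apply: (le_trans (ler_normD _ _)).
    rewrite (normrM x) (normrM (e * y)) (normrM e) e1 mul1r.
    rewrite !(ger0_norm (exprn_ge0 _ (ltW r0))) mulrDl lerD2l.
    have -> // : `|y| * t * r ^+ 3 = `|y| * r ^+ 2.
    by rewrite /t; field; rewrite gt_eqF.
  have : (`|x| + `|y| * t) * r ^+ 3 = r ^+ 4 * (t * (`|x| + `|y| * t)).
    by rewrite /t; field; rewrite gt_eqF.
  move=> ->.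
  apply: (@le_trans _ _ (r ^+ 4 * (1 / 2))); first by rewrite ler_pM2l ?exprn_gt0.
  by rewrite r4; lra.
have bi : `|2 * i%:R - m%:R : R| <= (m%:R + 1) / 2.
  by rewrite ki; have := kbound 1; rewrite normr1 mul1r; exact.
have bj : `|2 * j%:R - m%:R : R| <= (m%:R + 1) / 2.
  by rewrite kj; have := kbound (-1); rewrite normrN1 mulN1r mulNr; exact.
(* With k = r^3 (x + e y t) / 2 and M >= r^4 / 2, the error k^6 / M^5 of one block is at most half
   of the claimed total. *)
have esix (e : R) : `|e| = 1 ->
    ((x * r ^+ 3 + e * y * r ^+ 2) / 2) ^+ 6 / (m%:R + 1) ^+ 5 <=
    t ^+ 2 * (`|x| + `|y| * t) ^+ 6 / 2.
  move=> e1.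
  have M0 : 0 < (m%:R + 1 : R) by rewrite ltr_wpDl.
  rewrite ler_pdivrMr ?exprn_gt0//.
  have -> : (x * r ^+ 3 + e * y * r ^+ 2) / 2 = r ^+ 3 * (x + e * y * t) / 2.
    by rewrite /t; field; rewrite gt_eqF.
  have n6 : (x + e * y * t) ^+ 6 <= (`|x| + `|y| * t) ^+ 6.
    rewrite -[leLHS]ger0_norm ?(@exprn_even_ge0 _ 6)// normrX lerXn2r ?nnegrE//.
      by rewrite addr_ge0// mulr_ge0// invr_ge0 ltW.
    apply: (le_trans (ler_normD _ _)).
    by rewrite !normrM e1 mul1r lerD2l (ger0_norm (_ : 0 <= t))// invr_ge0 ltW.
  have m5 : (r ^+ 4 / 2) ^+ 5 <= (m%:R + 1) ^+ 5.
    by rewrite lerXn2r ?nnegrE ?divr_ge0 ?exprn_ge0 ?(ltW r0)// ?(ltW M0)// r4; lra.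
  apply: (@le_trans _ _ (t ^+ 2 * (`|x| + `|y| * t) ^+ 6 / 2 * (r ^+ 4 / 2) ^+ 5));
    last first.
    by rewrite ler_wpM2l// divr_ge0// mulr_ge0 ?(@exprn_even_ge0 _ 6) ?(@exprn_even_ge0 _ 2).
  have -> : t ^+ 2 * (`|x| + `|y| * t) ^+ 6 / 2 * (r ^+ 4 / 2) ^+ 5 =
    (`|x| + `|y| * t) ^+ 6 * (r ^+ 3 / 2) ^+ 6.
    rewrite (_ : t ^+ 2 = r ^- 2); last by rewrite exprVn.
    set q := (_ + _) ^+ 6; by field; rewrite gt_eqF.
  rewrite (_ : (r ^+ 3 * _ / 2) ^+ 6 = (x + e * y * t) ^+ 6 * (r ^+ 3 / 2) ^+ 6); last by field.
  by rewrite ler_wpM2r// exprn_ge0// divr_ge0// exprn_ge0// ltW.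
have si := esix 1; have sj := esix (-1).
rewrite normr1 mul1r -ki in si; rewrite normrN1 mulN1r mulNr -kj in sj.
have {}si := si erefl; have {}sj := sj erefl.
have {}li := li bi; have {}lj := lj bj.
move: li lj si sj; set P1 := logbin_profile _ _ _; set P2 := logbin_profile _ _ _.
set E6 := t ^+ 2 * _; move=> *; lra.
Qed.

Lemma mag_bounds m r i j : 0 < r -> r ^+ 4 = 2 * m%:R ->
  (i <= m)%N -> (j <= m)%N -> `|magx r m i j| <= r /\ `|magy r m i j| <= r ^+ 2.
Proof.
move=> r0 r4 im jm.
have := im; rewrite -(ler_nat R) => im'; have := jm; rewrite -(ler_nat R) => jm'.
have i0 := ler0n R i; have j0 := ler0n R j.
rewrite /magx /magy !normrM !normfV !(ger0_norm (exprn_ge0 _ (ltW r0))).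
rewrite !ler_pdivrMr ?exprn_gt0// -exprS -exprD r4.
by split; rewrite ler_norml; apply/andP; split; lra.
Qed.

End weight.

(** * The cells of the rescaled lattice *)

Section cells.
Variable R : realType.
Implicit Types (r u v : R) (m i j : nat).

(* For fixed i - j, the sum A moves by steps of 4, whereas D moves by steps of 2:
   the cells are disjoint and tile the plane near the origin. *)
Definition in_cell r m i j u v : bool :=
  (magx R r m i j <= u < magx R r m i j + 4 / r ^+ 3) &&
  (magy R r m i j <= v < magy R r m i j + 2 / r ^+ 2).

Lemma in_cellE r m i j u v : 0 < r -> in_cell r m i j u v =
  [&& 2 * (i%:R + j%:R) - 2 * m%:R <= u * r ^+ 3,
      u * r ^+ 3 < 2 * (i%:R + j%:R) - 2 * m%:R + 4,
      2 * i%:R - 2 * j%:R <= v * r ^+ 2 &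
      v * r ^+ 2 < 2 * i%:R - 2 * j%:R + 2].
Proof.
move=> r0; rewrite /in_cell /magx /magy -!mulrDl.
have r30 := exprn_gt0 3 r0; have r20 := exprn_gt0 2 r0.
rewrite !(ler_pdivrMr _ _ r30) !(ler_pdivrMr _ _ r20).
rewrite !(ltr_pdivlMr _ _ r30) !(ltr_pdivlMr _ _ r20) -!andbA.
by apply/and4P/and4P => -[*]; split; lra.
Qed.

(** The coordinate [v] determines i - j. Then i + j has a fixed parity, and [u] locates it within
    less than 2. *)
Lemma in_cell_inj r m i j i' j' u v : 0 < r ->
  in_cell r m i j u v -> in_cell r m i' j' u v -> i = i' /\ j = j'.
Proof.
move=> r0; rewrite !in_cellE// => /and4P[a1 a2 a3 a4] /and4P[b1 b2 b3 b4].
have diff (p q p' q' : nat) : 2 * p%:R - 2 * q%:R <= v * r ^+ 2 ->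
    v * r ^+ 2 < 2 * p'%:R - 2 * q'%:R + 2 -> (p + q' < p' + q + 1)%N.
  by move=> h1 h2; rewrite -(ltr_nat R) !natrD; lra.
have d1 := diff _ _ _ _ a3 b4; have d2 := diff _ _ _ _ b3 a4.
have sum (p q p' q' : nat) : 2 * (p%:R + q%:R) - 2 * m%:R <= u * r ^+ 3 ->
    u * r ^+ 3 < 2 * (p'%:R + q'%:R) - 2 * m%:R + 4 -> (p + q < p' + q' + 2)%N.
  by move=> h1 h2; rewrite -(ltr_nat R) !natrD; lra.
have s1 := sum _ _ _ _ a1 b2; have s2 := sum _ _ _ _ b1 a2.
by split; lia.
Qed.

Lemma in_cell_exists r m u v : 0 < r -> r ^+ 4 = 2 * m%:R ->
  `|u| * r^-1 + 2 * `|v| * r^-1 ^+ 2 + 10 * r^-1 ^+ 4 <= 1 ->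
  exists i j, [/\ (i <= m)%N, (j <= m)%N & in_cell r m i j u v].
Proof.
move=> r0 r4 large.
have {}large : `|u| * r ^+ 3 + 2 * `|v| * r ^+ 2 + 10 <= 2 * m%:R.
  rewrite -r4 -(ler_pM2r (exprn_gt0 4 r0)) mul1r in large *.
  apply: le_trans large; rewrite le_eqVlt; apply/orP; left; apply/eqP.
  by field; rewrite gt_eqF.
have r30 := exprn_gt0 3 r0; have r20 := exprn_gt0 2 r0.
have := ler_norm (u * r ^+ 3); have := ler_norm (- (u * r ^+ 3)).
have := ler_norm (v * r ^+ 2); have := ler_norm (- (v * r ^+ 2)).
rewrite !normrN (normrM u) (normrM v) (gtr0_norm r30) (gtr0_norm r20).
move: large; rewrite -mulrA; set U := u * r ^+ 3; set V := v * r ^+ 2.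
set aU := `|u| * _; set aV := `|v| * _ => large V2 V1 U2 U1.
have aU0 : 0 <= aU by rewrite mulr_ge0// ltW.
have aV0 : 0 <= aV by rewrite mulr_ge0// ltW.
(* Here [q] is i - j and [t] is j, found from i + j = 2 j + q; the constant 10 in the hypothesis
   absorbs the rounding, so that both indices stay between 0 and [m]. *)
pose q := Num.floor (V / 2); pose t := Num.floor ((U / 2 + m%:R - q%:~R) / 2).
have /andP[q1 q2] := floor_itv (V / 2); have /andP[t1 t2] := floor_itv ((U / 2 + m%:R - q%:~R) / 2).
rewrite -/q -/t !intrD in q1 q2 t1 t2.
have i0 : 0 <= t + q by rewrite -ltzD1 -(ltr_int R) !intrD; lra.
have j0 : 0 <= t by rewrite -ltzD1 -(ltr_int R) !intrD; lra.
exists (absz (t + q)), (absz t).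
have iE : (absz (t + q))%:R = t%:~R + q%:~R :> R.
  by rewrite natr_absz ger0_norm// intrD.
have jE : (absz t)%:R = t%:~R :> R by rewrite natr_absz ger0_norm.
split.
- by rewrite -(ler_nat R) iE; lra.
- by rewrite -(ler_nat R) jE; lra.
- by rewrite in_cellE// iE jE; apply/and4P; split; rewrite -/U -/V; lra.
Qed.

Lemma in_cell_dist r m i j u v : 0 < r -> in_cell r m i j u v ->
  `|magx R r m i j - u| <= 4 * r^-1 ^+ 3 /\ `|magy R r m i j - v| <= 2 * r^-1 ^+ 2.
Proof.
move=> r0 /andP[/andP[x1 x2] /andP[y1 y2]].
rewrite !exprVn !ler_norml.
by split; apply/andP; split; [lra| |lra|];
   rewrite lerBlDr ler_wpDl// mulr_ge0// invr_ge0 exprn_ge0// ltW.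
Qed.

End cells.

(** * Pointwise limits of the exponent and of the weights *)

Section limits.
Variable R : realType.
Implicit Types (t x y : nat -> R).

Lemma cvg_exprn (a : nat -> R) (l : R) k :
  a n @[n --> \oo] --> l -> a n ^+ k @[n --> \oo] --> l ^+ k.
Proof. move=> al; apply: (@continuous_cvg _ _ _ _ _ a (fun z => z ^+ k) l) => //.
exact: exprn_continuous.
Qed.

(* The library versions are stated with [\+] and [\*], which do not unify with
   the pointwise expressions below. *)
Lemma cvg_addr (a b : nat -> R) (k l : R) :
  a n @[n --> \oo] --> k -> b n @[n --> \oo] --> l -> a n + b n @[n --> \oo] --> k + l.
Proof. exact: cvgD. Qed.

Lemma cvg_mulr (a b : nat -> R) (k l : R) :
  a n @[n --> \oo] --> k -> b n @[n --> \oo] --> l -> a n * b n @[n --> \oo] --> k * l.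
Proof. exact: cvgM. Qed.

Lemma cvg_eq (a : nat -> R) (k l : R) : a n @[n --> \oo] --> k -> k = l ->
  a n @[n --> \oo] --> l.
Proof. by move=> ak <-. Qed.

Lemma cvg_invr (a : nat -> R) (k : R) : k != 0 ->
  a n @[n --> \oo] --> k -> (a n)^-1 @[n --> \oo] --> k^-1.
Proof. exact: cvgV. Qed.

Lemma cvg_expr (a : nat -> R) (l : R) :
  a n @[n --> \oo] --> l -> expR (a n) @[n --> \oo] --> expR l.
Proof.
move=> al; apply: (@continuous_cvg _ _ _ _ _ a expR l) => //.
exact: continuous_expR.
Qed.

Lemma cvg_rescaled_exponent (alpha : R) t x y (u v : R) :
  t n @[n --> \oo] --> 0 -> x n @[n --> \oo] --> u -> y n @[n --> \oo] --> v ->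
  rescaled_exponent R alpha (t n) (x n) (y n) @[n --> \oo] -->
    - (u ^+ 4) / 12 - (alpha * v ^+ 2) / 2.
Proof.
move=> t0 xu yv; rewrite /rescaled_exponent.
have tk k : t n ^+ k.+1 @[n --> \oo] --> 0.
  by apply: (cvg_eq _ _ _ (cvg_exprn _ _ k.+1 t0)); rewrite expr0n.
have xk k := cvg_exprn _ _ k xu; have yk k := cvg_exprn _ _ k yv.
have den : 1 + 2 * t n ^+ 4 @[n --> \oo] --> (1 : R).
  apply: (cvg_eq _ (1 + 2 * 0)); last by rewrite mulr0 addr0.
  by apply: cvg_addr; [exact: cvg_cst|apply: cvg_mulr; [exact: cvg_cst|exact: tk]].
have vden : (1 + 2 * t n ^+ 4)^-1 @[n --> \oo] --> (1 : R).
  by apply: (cvg_eq _ 1^-1); [exact: cvg_invr (oner_neq0 _) den|exact: invr1].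
have vden3 : ((1 + 2 * t n ^+ 4) ^+ 3)^-1 @[n --> \oo] --> (1 : R).
  apply: (cvg_eq _ (1 ^+ 3)^-1); last by rewrite expr1n invr1.
  by apply: cvg_invr; [rewrite expr1n oner_neq0|exact: cvg_exprn].
have vden12 : (12 * (1 + 2 * t n ^+ 4) ^+ 3)^-1 @[n --> \oo] --> (12^-1 : R).
  under eq_fun do rewrite invfM.
  apply: (cvg_eq _ (12^-1 * 1)); last exact: mulr1.
  by apply: cvg_mulr => //; exact: cvg_cst.
(* The limit is rewritten in the shape of the exponent itself, each positive power of [t] replaced
   by 0, so that the limit rules apply term by term. *)
have -> : - (u ^+ 4) / 12 - (alpha * v ^+ 2) / 2 =
   - (alpha * v ^+ 2) / 2 + (u ^+ 2 * 0 + v ^+ 2 * 0) * 1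
   - (u ^+ 4 + 6 * u ^+ 2 * v ^+ 2 * 0 + v ^+ 4 * 0) * 12^-1
   + 2 / 3 * (u ^+ 2 * 0 + v ^+ 2 * 0) * 1 by field.
by repeat first [ exact: cvg_cst | exact: tk | exact: xk | exact: yk
  | exact: vden | exact: vden3 | exact: vden12 | apply: cvg_addr | apply: cvg_mulr | apply: cvgN].
Qed.

(** The two bounds on the weight differ by an error in the exponent that vanishes with [t], and the
    condition guarding the lower bound holds eventually. *)
Lemma cvg_weight_squeeze (alpha : R) t x y (u v : R) (w : nat -> R) :
  t n @[n --> \oo] --> 0 -> x n @[n --> \oo] --> u -> y n @[n --> \oo] --> v ->
  (\forall n \near \oo, w n <= expR (rescaled_exponent R alpha (t n) (x n) (y n)) /\
    (t n * (`|x n| + `|y n| * t n) <= 1 / 2 ->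
     expR (rescaled_exponent R alpha (t n) (x n) (y n)
       - t n ^+ 2 * (`|x n| + `|y n| * t n) ^+ 6) <= w n)) ->
  w n @[n --> \oo] --> expR (- (u ^+ 4) / 12) * expR (- (alpha * v ^+ 2) / 2).
Proof.
move=> t0 xu yv wP; rewrite -expRD (mulNr (alpha * _)).
have QL := cvg_rescaled_exponent alpha _ _ _ _ _ t0 xu yv.
have nxy : `|x n| + `|y n| * t n @[n --> \oo] --> `|u|.
  apply: (cvg_eq _ (`|u| + `|v| * 0)); last by rewrite mulr0 addr0.
  by apply: cvg_addr; [exact: cvg_norm|apply: cvg_mulr => //; exact: cvg_norm].
have small : t n * (`|x n| + `|y n| * t n) @[n --> \oo] --> 0.
  by apply: (cvg_eq _ (0 * `|u|)); [exact: cvg_mulr|exact: mul0r].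
have err : t n ^+ 2 * (`|x n| + `|y n| * t n) ^+ 6 @[n --> \oo] --> 0.
  apply: (cvg_eq _ (0 ^+ 2 * (`|u| ^+ 6))); last by rewrite expr0n mul0r.
  by apply: cvg_mulr; exact: cvg_exprn.
pose hi n := expR (rescaled_exponent R alpha (t n) (x n) (y n)).
pose lo n := expR (rescaled_exponent R alpha (t n) (x n) (y n)
  - t n ^+ 2 * (`|x n| + `|y n| * t n) ^+ 6).
have hil : hi n @[n --> \oo] --> expR (- (u ^+ 4) / 12 - (alpha * v ^+ 2) / 2).
  exact: cvg_expr.
have lol : lo n @[n --> \oo] --> expR (- (u ^+ 4) / 12 - (alpha * v ^+ 2) / 2).
  apply: cvg_expr.
  by apply: (cvg_eq _ (- (u ^+ 4) / 12 - (alpha * v ^+ 2) / 2 - 0)); [exact: cvgB|exact: subr0].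
apply: (squeeze_cvgr _ lol hil).
have half : (0 : R) < 1 / 2 by rewrite divr_gt0.
have smalln : \forall n \near \oo, t n * (`|x n| + `|y n| * t n) <= 1 / 2.
  exact: (cvgr_le _ small _ half).
apply: filterS2 wP smalln => n [wu wl] /wl wl'.
by apply/andP; split.
Qed.

End limits.

(** * Riemann sums *)

Section riemann_sum.
Variable R : realType.
Notation mu := (@lebesgue_measure R).
Variables (alpha : R) (f g : R -> R).
Hypothesis alpha0 : 0 < alpha.
Hypotheses (cf : continuous f) (cg : continuous g).
Variables Bf Bg : R.
Hypotheses (fB : forall x, `|f x| <= Bf) (gB : forall x, `|g x| <= Bg).

Definition cell_value (c r : R) (m i j : nat) : R :=
  cell_weight R alpha c m i j * (f (magx R r m i j) * g (magy R r m i j)).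

(** A product of one-variable indicators, so that its integral over the plane factorises. *)
Definition cell_ind (r : R) (m i j : nat) (z : measurableTypeR R * measurableTypeR R) : R :=
  \1_(`[magx R r m i j, magx R r m i j + 4 / r ^+ 3[%classic) z.1 *
  \1_(`[magy R r m i j, magy R r m i j + 2 / r ^+ 2[%classic) z.2.

Definition step_fun (c r : R) (m : nat) (z : measurableTypeR R * measurableTypeR R) : R :=
  \sum_(p : 'I_m.+1 * 'I_m.+1) cell_value c r m p.1 p.2 * cell_ind r m p.1 p.2 z.

Lemma cell_indE r m i j z : cell_ind r m i j z = (in_cell R r m i j z.1 z.2)%:R.
Proof.
rewrite /cell_ind !indicE /in_cell -natrM mulnb; congr ((_ && _)%:R).
  by apply/idP/idP; rewrite inE/= in_itv.
by apply/idP/idP; rewrite inE/= in_itv.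
Qed.

Lemma step_fun_in c r m i j z : 0 < r -> (i <= m)%N -> (j <= m)%N ->
  in_cell R r m i j z.1 z.2 -> step_fun c r m z = cell_value c r m i j.
Proof.
move=> r0 im jm zij; rewrite /step_fun.
have im' : (i < m.+1)%N by []. have jm' : (j < m.+1)%N by [].
rewrite (bigD1 (Ordinal im', Ordinal jm'))//= cell_indE zij mulr1 big1 ?addr0//.
move=> [i' j'] /= ne; rewrite cell_indE.
case: (boolP (in_cell _ _ _ _ _ _ _)) => [zij'|_]; last by rewrite mulr0.
have [ei ej] := in_cell_inj _ _ _ _ _ _ _ _ _ r0 zij zij'.
by case/eqP: ne; congr (_, _); apply: val_inj.
Qed.

Lemma step_fun_cases c r m z : 0 < r -> step_fun c r m z = 0 \/
  exists i j, [/\ (i <= m)%N, (j <= m)%N, in_cell R r m i j z.1 z.2 &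
    step_fun c r m z = cell_value c r m i j].
Proof.
move=> r0; have [[p zp]|no] :=
    pselect (exists p : 'I_m.+1 * 'I_m.+1, in_cell R r m p.1 p.2 z.1 z.2).
  have p1 : (p.1 <= m)%N by rewrite -ltnS.
  have p2 : (p.2 <= m)%N by rewrite -ltnS.
  by right; exists p.1, p.2; split => //; exact: step_fun_in.
left; rewrite /step_fun big1// => p _; rewrite cell_indE.
case: (boolP (in_cell _ _ _ _ _ _ _)) => [zp|_]; last by rewrite mulr0.
by exfalso; apply: no; exists p.
Qed.

Lemma integrable_cell_ind r m i j :
  (mu \x mu)%E.-integrable setT (EFin \o cell_ind r m i j).
Proof. by apply: integrable_prod_mul; exact: integrable_indic_itv. Qed.

Lemma integral_cell_ind r m i j : 0 < r ->
  (\int[mu \x mu]_z (cell_ind r m i j z)%:E = (8 / r ^+ 5)%:E)%E.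
Proof.
move=> r0; rewrite integral_prod_mul; try exact: integrable_indic_itv.
rewrite !integral_indic ?setIT//=.
rewrite !lebesgue_measure_itv/= !lte_fin !ltrDl !divr_gt0 ?exprn_gt0//.
rewrite -!EFinD -EFinM; congr EFin; field.
by rewrite gt_eqF.
Qed.

Lemma measurable_step_fun c r m : measurable_fun setT (step_fun c r m).
Proof.
apply: measurable_sum => p; apply: measurable_funM => //.
apply/measurable_EFinP.
exact: (measurable_int (mu \x mu)%E (integrable_cell_ind r m p.1 p.2)).
Qed.

(** Every cell has the same area (4 / r^3) (2 / r^2) = 8 / r^5, which turns the partition sum into
    an integral. *)
Lemma integral_step_fun c r m : 0 < r ->
  (\int[mu \x mu]_z (step_fun c r m z)%:E =
  (8 / r ^+ 5 * expR (- (2 * c)) * block_sum R m 1 (1 - alpha)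
     (fun A D => f (A / r ^+ 3) * g (D / r ^+ 2)))%:E)%E.
Proof.
move=> r0; rewrite /step_fun.
under eq_integral do rewrite -sumEFin.
rewrite integral_sum//; last first.
  move=> p; under eq_fun do rewrite EFinM.
  by apply: integrableZl => //; exact: integrable_cell_ind.
rewrite (eq_bigr (fun p : 'I_m.+1 * 'I_m.+1 =>
    (8 / r ^+ 5 * cell_value c r m p.1 p.2)%:E)); last first.
  move=> p _; under eq_integral do rewrite EFinM.
  rewrite integralZl//; last exact: integrable_cell_ind.
  by rewrite integral_cell_ind// -EFinM mulrC.
rewrite sumEFin; congr EFin.
rewrite -mulr_sumr -mulrA; congr (_ * _).
rewrite /block_sum pair_big/= mulr_sumr; apply: eq_bigr => p _.
by rewrite /cell_value /cell_weight -!mulrA.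
Qed.

(** A cell corner (x, y) lies within 4 and 2 of z. Then x^4 / 96 >= (2 x^2 - 1) / 96 with x^2 >=
    z.1^2 / 2 - 16, and y^2 >= z.2^2 / 2 - 4, which gives these Gaussian rates; 4 exceeds 3 + 1/96 +
    1/3. *)
Definition dominating (z : measurableTypeR R * measurableTypeR R) : R :=
  (Bf * Bg * expR (4 + 2 * alpha)) *
  (expR (- ((1 / 48) * z.1 ^+ 2) / 2) * expR (- ((alpha / 2) * z.2 ^+ 2) / 2)).

Lemma integrable_dominating : (mu \x mu)%E.-integrable setT (EFin \o dominating).
Proof.
rewrite /dominating /comp; under eq_fun do rewrite EFinM.
apply: integrableZl => //.
apply: (integrable_prod_mul _ _ _ _ _ mu mu (fun x => expR (- ((1 / 48) * x ^+ 2) / 2))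
  (fun y => expR (- ((alpha / 2) * y ^+ 2) / 2))).
  by apply: integrable_gaussian; lra.
by apply: integrable_gaussian; rewrite divr_gt0.
Qed.

Let Bf0 : 0 <= Bf. Proof. exact: le_trans (normr_ge0 _) (fB 0). Qed.
Let Bg0 : 0 <= Bg. Proof. exact: le_trans (normr_ge0 _) (gB 0). Qed.

Lemma step_fun_le_dominating c r m z : 0 < r -> r ^+ 4 = 2 * m%:R -> (0 < m)%N ->
  (forall i j, (i <= m)%N -> (j <= m)%N -> cell_weight R alpha c m i j <=
     expR (rescaled_exponent R alpha r^-1 (magx R r m i j) (magy R r m i j))) ->
  `|step_fun c r m z| <= dominating z.
Proof.
move=> r0 r4 m0 wP.
have [->|[i [j [im jm zij ->]]]] := step_fun_cases c r m z r0.
  by rewrite normr0 /dominating !mulr_ge0 ?expR_ge0.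
have r4_ge2 : 2 <= r ^+ 4 by rewrite r4 -[leLHS]mulr1 ler_pM2l// ler1n.
have r1 : 1 <= r.
  rewrite leNgt; apply/negP => r1; have : r ^+ 4 <= 1 by rewrite exprn_ile1// ltW.
  by move: r4_ge2; lra.
have [dx dy] := in_cell_dist _ _ _ _ _ _ _ r0 zij.
have [xr yr] := mag_bounds R m r i j r0 r4 im jm.
have {}wP := wP i j im jm.
rewrite /cell_value normrM ger0_norm; last first.
  by rewrite /cell_weight !mulr_ge0 ?expR_ge0.
rewrite /dominating -mulrA mulrC -!expRD.
apply: ler_pM; rewrite ?normr_ge0//.
- by rewrite /cell_weight !mulr_ge0 ?expR_ge0.
- by rewrite normrM ler_pM.
apply: (le_trans wP); rewrite ler_expR.
apply: (le_trans (rescaled_exponent_le R alpha r _ _ r0 r4_ge2 xr yr)).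
set x := magx R r m i j in dx *; set y := magy R r m i j in dy *.
have ri1 : r^-1 <= 1 by rewrite invf_le1.
have ri0 : 0 <= r^-1 by rewrite invr_ge0 ltW.
have {}dx : `|x - z.1| <= 4.
  by apply: (le_trans dx); rewrite -[leRHS]mulr1 ler_pM2l// exprn_ile1.
have {}dy : `|y - z.2| <= 2.
  by apply: (le_trans dy); rewrite -[leRHS]mulr1 ler_pM2l// exprn_ile1.
have dx2 : (x - z.1) ^+ 2 <= 16.
  rewrite -real_normK ?num_real// (_ : 16 = 4 ^+ 2); last by ring.
  by rewrite lerXn2r ?nnegrE.
have dy2 : (y - z.2) ^+ 2 <= 4.
  rewrite -real_normK ?num_real// (_ : 4 = 2 ^+ 2); last by ring.
  by rewrite lerXn2r ?nnegrE.
(* This bound and the next are instances of z^2 <= 2 x^2 + 2 (x - z)^2, that is, (2 x - z)^2 >=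
   0. *)
have hx : z.1 ^+ 2 <= 2 * x ^+ 2 + 32.
  have : 0 <= (x + (x - z.1)) ^+ 2 by exact: sqr_ge0.
  nra.
have hy : z.2 ^+ 2 / 2 - 4 <= y ^+ 2.
  have : 0 <= (y + (y - z.2)) ^+ 2 by exact: sqr_ge0.
  nra.
have x4 : 2 * x ^+ 2 - 1 <= x ^+ 4.
  by have := sqr_ge0 (x ^+ 2 - 1); rewrite (_ : x ^+ 4 = (x ^+ 2) ^+ 2); [nra|ring].
have : alpha * (z.2 ^+ 2 / 2 - 4) <= alpha * y ^+ 2 by rewrite ler_pM2l.
lra.
Qed.

End riemann_sum.

(** * Convergence *)

Section scaling.
Variable R : realType.

Definition fourth_root (n : nat) : R := powR (2 * n.+1)%N%:R 4^-1.

Lemma fourth_root_gt0 n : 0 < fourth_root n.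
Proof. by rewrite powR_gt0// ltr0n muln_gt0. Qed.

Lemma fourth_rootX n : fourth_root n ^+ 4 = 2 * n.+1%:R.
Proof.
rewrite -powR_mulrn ?ltW ?fourth_root_gt0// -powRrM mulVf ?pnatr_eq0//.
by rewrite powRr1 ?ler0n// natrM.
Qed.

Lemma fourth_rootX2 n : Num.sqrt (2 * n.+1)%N%:R = fourth_root n ^+ 2.
Proof.
rewrite natrM -fourth_rootX (_ : fourth_root n ^+ 4 = (fourth_root n ^+ 2) ^+ 2).
  by rewrite sqrtr_sqr ger0_norm// exprn_ge0// ltW// fourth_root_gt0.
by ring.
Qed.

(** The fourth power is half the harmonic sequence; two square roots bring the limit back. *)
Lemma cvg_fourth_rootV : (fourth_root n)^-1 @[n --> \oo] --> (0 : R).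
Proof.
have h4 : (fourth_root n)^-1 ^+ 4 @[n --> \oo] --> (0 : R).
  apply: (cvg_eq _ _ (2^-1 * 0)); last exact: mulr0.
  rewrite (_ : (fun n => _) = (fun n => 2^-1 * harmonic n)).
    by apply: cvg_mulr; [exact: cvg_cst|exact: cvg_harmonic].
  by apply/funext => n; rewrite exprVn fourth_rootX invfM.
have sq : Num.sqrt (Num.sqrt ((fourth_root n)^-1 ^+ 4)) @[n --> \oo] --> (0 : R).
  have sqrt_cvg (a : nat -> R) l : a n @[n --> \oo] --> l ->
      Num.sqrt (a n) @[n --> \oo] --> Num.sqrt l.
    move=> al; apply: (@continuous_cvg _ _ _ _ _ a Num.sqrt l) => //.
    exact: sqrt_continuous.
  apply: (cvg_eq _ _ (Num.sqrt (Num.sqrt 0))); last by rewrite !sqrtr0.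
  exact: (sqrt_cvg _ _ (sqrt_cvg _ _ h4)).
rewrite (_ : (fun n => _) = (fun n => Num.sqrt (Num.sqrt ((fourth_root n)^-1 ^+ 4))))//.
apply/funext => n; have r0 := fourth_root_gt0 n.
rewrite (_ : _ ^+ 4 = ((fourth_root n)^-1 ^+ 2) ^+ 2); last by ring.
have t0 : 0 <= (fourth_root n)^-1 by rewrite invr_ge0 ltW.
by rewrite sqrtr_sqr (ger0_norm (exprn_ge0 2 t0)) sqrtr_sqr ger0_norm.
Qed.

End scaling.

Section convergence.
Variable R : realType.
Notation mu := (@lebesgue_measure R).
Variable alpha : R.
Hypothesis alpha0 : 0 < alpha.
Notation r := (fourth_root R).
Variable c : nat -> R.
Hypothesis cP : forall n i j, (i <= n.+1)%N -> (j <= n.+1)%N ->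
  let x := magx R (r n) n.+1 i j in let y := magy R (r n) n.+1 i j in let t := (r n)^-1 in
  cell_weight R alpha (c n) n.+1 i j <= expR (rescaled_exponent R alpha t x y) /\
  (t * (`|x| + `|y| * t) <= 1 / 2 ->
   expR (rescaled_exponent R alpha t x y - t ^+ 2 * (`|x| + `|y| * t) ^+ 6)
     <= cell_weight R alpha (c n) n.+1 i j).
Variables f g : R -> R.
Hypotheses (cf : continuous f) (cg : continuous g).
Hypotheses (bf : exists M, forall x, `|f x| <= M) (bg : exists M, forall x, `|g x| <= M).

(** Eventually [z] lies in a cell, whose corner converges to [z] while its weight is squeezed. *)
Lemma step_fun_cvg (z : measurableTypeR R * measurableTypeR R) :
  step_fun R alpha f g (c n) (r n) n.+1 z @[n --> \oo] -->
  (f z.1 * expR (- (z.1 ^+ 4) / 12)) * (g z.2 * expR (- (alpha * z.2 ^+ 2) / 2)).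
Proof.
pose t n := (r n)^-1; have t0 : t n @[n --> \oo] --> 0 := cvg_fourth_rootV R.
pose large n := `|z.1| * t n + 2 * `|z.2| * t n ^+ 2 + 10 * t n ^+ 4 <= 1.
have nearlarge : \forall n \near \oo, large n.
  have h : `|z.1| * t n + 2 * `|z.2| * t n ^+ 2 + 10 * t n ^+ 4 @[n --> \oo] --> 0.
    apply: (cvg_eq _ _ (`|z.1| * 0 + 2 * `|z.2| * 0 ^+ 2 + 10 * 0 ^+ 4)).
      by repeat first [exact: cvg_cst | exact: t0 | apply: cvg_addr | apply: cvg_mulr | apply: cvg_exprn].
    by rewrite !expr0n/= !mulr0 !addr0.
  exact: (cvgr_le _ h _ ltr01).
have pt n : exists p : R * R * R, [/\ `|p.1.1 - z.1| <= 4 * t n ^+ 3,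
    `|p.1.2 - z.2| <= 2 * t n ^+ 2 &
    large n -> [/\ step_fun R alpha f g (c n) (r n) n.+1 z = p.2 * (f p.1.1 * g p.1.2),
    p.2 <= expR (rescaled_exponent R alpha (t n) p.1.1 p.1.2) &
    (t n * (`|p.1.1| + `|p.1.2| * t n) <= 1 / 2 ->
     expR (rescaled_exponent R alpha (t n) p.1.1 p.1.2
       - t n ^+ 2 * (`|p.1.1| + `|p.1.2| * t n) ^+ 6) <= p.2)]].
  have r0 := fourth_root_gt0 R n.
  have tn0 : 0 <= t n by rewrite invr_ge0 ltW.
  have [ln|nl] := pselect (large n); last first.
    (* A default for the finitely many [n] where [z] may lie outside the cells; it keeps the
       distance bounds valid for all [n]. *)
    exists (z.1, z.2, 0); split => //=; rewrite subrr normr0.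
      by rewrite mulr_ge0// exprn_ge0.
    by rewrite mulr_ge0// exprn_ge0.
  have [i [j [im jm zij]]] := in_cell_exists R (r n) n.+1 z.1 z.2 r0 (fourth_rootX R n) ln.
  have [dx dy] := in_cell_dist _ _ _ _ _ _ _ r0 zij.
  have [wu wl] := cP n i j im jm.
  exists (magx R (r n) n.+1 i j, magy R (r n) n.+1 i j, cell_weight R alpha (c n) n.+1 i j).
  split => // _; split => //=.
  by rewrite (step_fun_in _ _ _ _ _ _ _ _ _ _ r0 im jm zij).
have [p pP] := choice pt.
have dist_cvg (a : nat -> R) (l k : R) m : (forall n, `|a n - l| <= k * t n ^+ m.+1) ->
    a n @[n --> \oo] --> l.
  move=> ae; have e0 : k * t n ^+ m.+1 @[n --> \oo] --> 0.
    apply: (cvg_eq _ _ (k * 0 ^+ m.+1)); last by rewrite expr0n mulr0.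
    by apply: cvg_mulr; [exact: cvg_cst|exact: cvg_exprn].
  apply: (squeeze_cvgr (f := fun n => l - k * t n ^+ m.+1)
                       (h := fun n => l + k * t n ^+ m.+1)).
  - by apply: nearW => n; have := ae n; rewrite ler_norml => /andP[]; lra.
  - by apply: (cvg_eq _ _ (l - 0)); [apply: cvgB => //; exact: cvg_cst|exact: subr0].
  - by apply: (cvg_eq _ _ (l + 0)); [apply: cvgD => //; exact: cvg_cst|exact: addr0].
pose x n := (p n).1.1; pose y n := (p n).1.2; pose w n := (p n).2.
have xz : x n @[n --> \oo] --> z.1.
  by apply: (dist_cvg _ _ 4 2%N) => n; have [] := pP n.
have yz : y n @[n --> \oo] --> z.2.
  by apply: (dist_cvg _ _ 2 1%N) => n; have [] := pP n.
have wz : w n @[n --> \oo] --> expR (- (z.1 ^+ 4) / 12) * expR (- (alpha * z.2 ^+ 2) / 2).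
  apply: (cvg_weight_squeeze R alpha t x y) => //.
  by apply: filterS nearlarge => n ln; have [_ _ /(_ ln)[_ ? ?]] := pP n.
have fx : f (x n) @[n --> \oo] --> f z.1 by apply: (@continuous_cvg _ _ _ _ _ x f z.1) => //; exact: cf.
have gy : g (y n) @[n --> \oo] --> g z.2 by apply: (@continuous_cvg _ _ _ _ _ y g z.2) => //; exact: cg.
have lim : w n * (f (x n) * g (y n)) @[n --> \oo] -->
  (f z.1 * expR (- (z.1 ^+ 4) / 12)) * (g z.2 * expR (- (alpha * z.2 ^+ 2) / 2)).
  rewrite mulrACA mulrC; apply: cvg_mulr => //; exact: cvg_mulr.
apply: cvg_trans lim; apply: near_eq_cvg.
by apply: filterS nearlarge => n ln; have [_ _ /(_ ln)[-> _ _]] := pP n.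
Qed.

(** Dominated convergence for the step functions; Fubini then splits the limit. The prefactor is the
    cell area times the normalisation of the weights. *)
Lemma block_sum_cvg :
  (8 / r n ^+ 5 * expR (- (2 * c n))) * block_sum R n.+1 1 (1 - alpha)
     (fun A D => f (A / r n ^+ 3) * g (D / r n ^+ 2)) @[n --> \oo] -->
  (\int[mu]_x (f x * expR (- (x ^+ 4) / 12))) *
  (\int[mu]_y (g y * expR (- (alpha * y ^+ 2) / 2))).
Proof.
have [Bf fB] := bf; have [Bg gB] := bg.
have ip := integrableM_bounded _ _ _ cf bf (integrable_quartic R).
have iq := integrableM_bounded _ _ _ cg bg (integrable_gaussian R alpha alpha0).
have ae1 : \forall z \ae (mu \x mu)%E, setT z ->
    (step_fun R alpha f g (c n) (r n) n.+1 z)%:E @[n --> \oo] -->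
    ((f z.1 * expR (- (z.1 ^+ 4) / 12)) * (g z.2 * expR (- (alpha * z.2 ^+ 2) / 2)))%:E.
  by apply: aeW => z _; apply: cvg_EFin; [exact: nearW|exact: step_fun_cvg].
have ae2 : \forall z \ae (mu \x mu)%E, forall n, setT z ->
    (`|(step_fun R alpha f g (c n) (r n) n.+1 z)%:E| <= (EFin \o dominating R alpha Bf Bg) z)%E.
  apply: aeW => z n _; rewrite /= lee_fin.
  apply: (step_fun_le_dominating R alpha f g alpha0 Bf Bg fB gB) => //.
  - exact: fourth_root_gt0.
  - exact: fourth_rootX.
  - by move=> i j im jm; have [] := cP n i j im jm.
have [_ _] := @dominated_convergence _ _ R (mu \x mu)%E setT measurableT
  (fun n z => (step_fun R alpha f g (c n) (r n) n.+1 z)%:E)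
  (fun z => ((f z.1 * expR (- (z.1 ^+ 4) / 12)) * (g z.2 * expR (- (alpha * z.2 ^+ 2) / 2)))%:E)
  (EFin \o dominating R alpha Bf Bg)
  (fun n => (measurable_EFinP _ _).2 (measurable_step_fun R alpha f g (c n) (r n) n.+1))
  (measurable_int _ (integrable_prod_mul _ _ _ _ _ mu mu _ _ ip iq))
  ae1 (integrable_dominating R alpha alpha0 Bf Bg) ae2.
rewrite (integral_prod_mul _ _ _ _ _ mu mu (fun x => f x * expR (- (x ^+ 4) / 12))
  (fun y => g y * expR (- (alpha * y ^+ 2) / 2)) ip iq).
rewrite -[X in (X * _)%E]fineK ?integrable_fin_num//.
rewrite -[X in (_ * X)%E]fineK ?integrable_fin_num// -EFinM.
under eq_fun do rewrite (integral_step_fun R alpha f g _ _ _ (fourth_root_gt0 R _)).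
by move/fine_cvgP => [].
Qed.

End convergence.

(** * The joint limit law and its marginals *)

Section joint_limit.
Variable R : realType.
Notation mu := (@lebesgue_measure R).

Lemma block_ratio_cvg (alpha : R) (f g : R -> R) : 0 < alpha ->
  continuous f -> continuous g ->
  (exists M, forall x, `|f x| <= M) -> (exists M, forall x, `|g x| <= M) ->
  block_sum R n.+1 1 (1 - alpha)
    (fun A D => f (A / fourth_root R n ^+ 3) * g (D / fourth_root R n ^+ 2)) /
  block_sum R n.+1 1 (1 - alpha) (fun _ _ => 1) @[n --> \oo] -->
  rho_law f * gauss_law alpha^-1 g.
Proof.
move=> alpha0 cf cg bf bg.
(* The constants do not depend on the test functions, so numerator and denominator carry the same
   prefactor. *)
have [c cP] := choice (fun n => cell_weight_bounds R n.+1).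
have c1 : continuous (fun _ : R => 1 : R) by move=> ?; exact: cvg_cst.
have b1 : exists M, forall x : R, `|1 : R| <= M by exists 1 => _; rewrite normr1.
have cP' n i j (im : (i <= n.+1)%N) (jm : (j <= n.+1)%N) := cP n alpha (fourth_root R n) i j
  isT (fourth_root_gt0 R n) (fourth_rootX R n) im jm.
have num := block_sum_cvg R alpha alpha0 c cP' f g cf cg bf bg.
have den := block_sum_cvg R alpha alpha0 c cP' (fun=> 1) (fun=> 1) c1 c1 b1 b1.
have K0 := rho_K_gt0 R; have G0 := integral_gaussian_gt0 R alpha alpha0.
rewrite rho_lawE// gauss_lawE// mulf_div.
have e1 (a : R -> R) : \int[mu]_x (1 * a x) = \int[mu]_x a x.
  by apply: eq_Rintegral => x _; rewrite mul1r.
rewrite !e1 in den.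
have := cvg_mulr _ _ _ _ _ num (cvg_invr _ _ _ (lt0r_neq0 (mulr_gt0 K0 G0)) den).
apply: cvg_trans; apply: near_eq_cvg; apply: nearW => n.
have s0 : 8 / fourth_root R n ^+ 5 * expR (- (2 * c n)) != 0.
  by rewrite gt_eqF// mulr_gt0 ?expR_gt0// divr_gt0// exprn_gt0// fourth_root_gt0.
rewrite -mulf_div divff// mul1r; congr (_ / _).
by apply: eq_block_sum => A D; rewrite mulr1.
Qed.

Lemma rho_law1 : rho_law (fun _ : R => 1) = 1.
Proof.
rewrite rho_lawE; last 2 first.
  by move=> ?; exact: cvg_cst.
  by exists 1 => _; rewrite normr1.
under eq_Rintegral do rewrite mul1r.
by rewrite divff// gt_eqF// rho_K_gt0.
Qed.

Lemma gauss_law1 (c : R) : 0 < c -> gauss_law c^-1 (fun _ : R => 1) = 1.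
Proof.
move=> c0; rewrite gauss_lawE//; last 2 first.
  by move=> ?; exact: cvg_cst.
  by exists 1 => _; rewrite normr1.
under eq_Rintegral do rewrite mul1r.
by rewrite divff// gt_eqF// integral_gaussian_gt0.
Qed.

(** The marginal in A of the joint limit, obtained with the constant test function 1 in D. *)
Lemma block_ratio_cvg_rho (alpha : R) (f : R -> R) : 0 < alpha ->
  continuous f -> (exists M, forall x, `|f x| <= M) ->
  block_sum R n.+1 1 (1 - alpha) (fun A _ => f (A / fourth_root R n ^+ 3)) /
  block_sum R n.+1 1 (1 - alpha) (fun _ _ => 1) @[n --> \oo] --> rho_law f.
Proof.
move=> alpha0 cf bf; have c1 : continuous (fun _ : R => 1 : R) by move=> ?; exact: cvg_cst.
have b1 : exists M, forall x : R, `|1 : R| <= M by exists 1 => _; rewrite normr1.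
have := block_ratio_cvg alpha f (fun=> 1) alpha0 cf c1 bf b1.
rewrite gauss_law1// mulr1; apply: cvg_trans; apply: near_eq_cvg; apply: nearW => n.
by congr (_ / _); apply: eq_block_sum => A D; rewrite mulr1.
Qed.

Lemma block_ratio_cvg_gauss (alpha : R) (g : R -> R) : 0 < alpha ->
  continuous g -> (exists M, forall x, `|g x| <= M) ->
  block_sum R n.+1 1 (1 - alpha) (fun _ D => g (D / fourth_root R n ^+ 2)) /
  block_sum R n.+1 1 (1 - alpha) (fun _ _ => 1) @[n --> \oo] --> gauss_law alpha^-1 g.
Proof.
move=> alpha0 cg bg; have c1 : continuous (fun _ : R => 1 : R) by move=> ?; exact: cvg_cst.
have b1 : exists M, forall x : R, `|1 : R| <= M by exists 1 => _; rewrite normr1.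
have := block_ratio_cvg alpha (fun=> 1) g alpha0 c1 cg b1 bg.
rewrite rho_law1 mul1r; apply: cvg_trans; apply: near_eq_cvg; apply: nearW => n.
by congr (_ / _); apply: eq_block_sum => A D; rewrite mul1r.
Qed.

End joint_limit.

(* N = 2 * n.+1 ranges over the positive even integers; Sb n is S_N. *)
Theorem theorem3p1 (R : realType) (alpha beta : R)
    (Sb : forall n : nat, {set 'I_(2 * n.+1)}) :
  0 < beta -> `|alpha| < beta -> `|alpha| + beta = 2 ->
  (forall n, #|Sb n| = n.+1) ->
  let N n : R := (2 * n.+1)%N%:R in
  let E (T : forall n, {ffun 'I_(2 * n.+1) -> bool} -> R) n (f : R -> R) : R :=
    gibbs_E alpha beta (Sb n) (fun sigma => f (T n sigma)) in
  ((0 < alpha ->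
      cvg_in_law
        (E (fun n sigma => Num.sqrt (N n) / 2 * (mag1 (Sb n) sigma - mag2 (Sb n) sigma)))
        (gauss_law (2 / (2 - (beta - alpha)))))
   /\ (alpha < 0 ->
      cvg_in_law
        (E (fun n sigma => powR (N n) (4^-1) / 2 * (mag1 (Sb n) sigma - mag2 (Sb n) sigma)))
        rho_law))
  /\
  ((0 < alpha ->
      cvg_in_law
        (E (fun n sigma => powR (N n) (4^-1) / 2 * (mag1 (Sb n) sigma + mag2 (Sb n) sigma)))
        rho_law)
   /\ (alpha < 0 ->
      cvg_in_law
        (E (fun n sigma => Num.sqrt (N n) / 2 * (mag1 (Sb n) sigma + mag2 (Sb n) sigma)))
        (gauss_law (- alpha^-1)))).
Proof.
move=> beta0 ltab eqab cardS N E.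
(* With r the fourth root of N, the block size is r^4 / 2, so the normalisations of the statement
   become the scales r^2 and r^3. *)
have sq_scale n (D : R) : Num.sqrt (N n) / 2 * (D / n.+1%:R) = D / fourth_root R n ^+ 2.
  rewrite /N fourth_rootX2 (_ : n.+1%:R = fourth_root R n ^+ 4 / 2).
    by field; rewrite gt_eqF// fourth_root_gt0.
  by rewrite fourth_rootX; field.
have rt_scale n (A : R) : powR (N n) 4^-1 / 2 * (A / n.+1%:R) = A / fourth_root R n ^+ 3.
  rewrite -/(fourth_root R n) (_ : n.+1%:R = fourth_root R n ^+ 4 / 2).
    by field; rewrite gt_eqF// fourth_root_gt0.
  by rewrite fourth_rootX; field.
have subE (m A D : R) : m != 0 -> (A + D) / (2 * m) - (A - D) / (2 * m) = D / m.
  by move=> m0; field.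
have addE (m A D : R) : m != 0 -> (A + D) / (2 * m) + (A - D) / (2 * m) = A / m.
  by move=> m0; field.
have EE n (F : R -> R -> R) := gibbs_E_block_sum R n.+1 (Sb n) (cardS n) alpha beta F isT.
(* Criticality: A carries the coefficient 1 when alpha is positive, D when it is negative. *)
have half1 : 0 < alpha -> (beta + alpha) / 2 = 1 /\ (beta - alpha) / 2 = 1 - alpha.
  by move=> a0; move: eqab; rewrite gtr0_norm//; split; lra.
have half2 : alpha < 0 -> (beta - alpha) / 2 = 1 /\ (beta + alpha) / 2 = 1 - - alpha.
  by move=> a0; move: eqab; rewrite ltr0_norm//; split; lra.
split; split => alpha0 f cf bf.
- have [h1 h2] := half1 alpha0.
  have -> : 2 / (2 - (beta - alpha)) = alpha^-1.
    rewrite (_ : beta - alpha = 2 - 2 * alpha); last by lra.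
    by field; rewrite gt_eqF//; lra.
  apply: cvg_trans (block_ratio_cvg_gauss R alpha f alpha0 cf bf).
  apply: near_eq_cvg; apply: nearW => n.
  rewrite /E (EE n (fun a b => f (Num.sqrt (N n) / 2 * (a - b)))) h1 h2.
  by congr (_ / _); apply: eq_block_sum => A D; rewrite subE ?pnatr_eq0// sq_scale.
- have [h1 h2] := half2 alpha0.
  have na0 : 0 < - alpha by rewrite oppr_gt0.
  apply: cvg_trans (block_ratio_cvg_rho R (- alpha) f na0 cf bf).
  apply: near_eq_cvg; apply: nearW => n.
  rewrite /E (EE n (fun a b => f (powR (N n) 4^-1 / 2 * (a - b)))) h1 h2.
  (* For negative alpha the roles of A and D are exchanged, which reduces to the parameter
     [- alpha]. *)
  rewrite !(block_sumC _ _ (1 - - alpha)).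
  by congr (_ / _); apply: eq_block_sum => A D; rewrite subE ?pnatr_eq0// rt_scale.
- have [h1 h2] := half1 alpha0.
  apply: cvg_trans (block_ratio_cvg_rho R alpha f alpha0 cf bf).
  apply: near_eq_cvg; apply: nearW => n.
  rewrite /E (EE n (fun a b => f (powR (N n) 4^-1 / 2 * (a + b)))) h1 h2.
  by congr (_ / _); apply: eq_block_sum => A D; rewrite addE ?pnatr_eq0// rt_scale.
- have [h1 h2] := half2 alpha0.
  have na0 : 0 < - alpha by rewrite oppr_gt0.
  rewrite -invrN.
  apply: cvg_trans (block_ratio_cvg_gauss R (- alpha) f na0 cf bf).
  apply: near_eq_cvg; apply: nearW => n.
  rewrite /E (EE n (fun a b => f (Num.sqrt (N n) / 2 * (a + b)))) h1 h2.
  rewrite !(block_sumC _ _ (1 - - alpha)).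
  by congr (_ / _); apply: eq_block_sum => A D; rewrite addE ?pnatr_eq0// sq_scale.
Qed.
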